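(* Let $f\in L_2(\mathbb{R}^d)$ be admissible and $\lambda>0$. Then $$\lim_{\lambda\to\infty}\mathrm{UP}_{\mathrm{GG}}^{\mathbb{T}^d}(f_\lambda^{\mathrm{per}})=\mathrm{UP}_{\mathrm{GG}}(f).$$
   Context: Notation: $d\in\mathbb{N}$; $\langle x,y\rangle$ and $\|x\|$ are the Euclidean inner product and norm on $\mathbb{R}^d$; $\mathbb{T}^d=\mathbb{R}^d/\mathbb{Z}^d$, identified with $[-1/2,1/2)^d$; functions are complex-valued; $\|f\|_2$, $\langle f,g\rangle=\int_{\mathbb{R}^d}f\overline g$ are the norm and inner product of $L_2(\mathbb{R}^d)$, while $\|f\|_{\mathbb{T}^d}$, $\langle f,g\rangle_{\mathbb{T}^d}=\int_{\mathbb{T}^d}f\overline g$ are those of $L_2(\mathbb{T}^d)$. $H^1$ denotes the $L_2$ functions all of whose first-order derivatives are in $L_2$. The Fourier transform is $\widehat f(\xi)=\int_{\mathbb{R}^d}f(x)\mathrm{e}^{-2\pi\mathrm{i}\langle x,\xi\rangle}\,\mathrm{d}x$. Non-periodic case. For $j=1,\dots,d$: $\mathcal{A}_jf(x)=2\pi x_jf(x)$, $\mathcal{B}_jf(x)=\frac{\mathrm{i}}{2\pi}\frac{\partial f}{\partial x_j}(x)$; $\Delta(\mathcal{A},f)=\|\mathcal{A}f\|_2^2-\frac{|\langle\mathcal{A}f,f\rangle|^2}{\|f\|_2^2}$; and $$\mathrm{UP}_{\mathrm{GG}}(f)=\frac1{d^2\|f\|_2^4}\sum_{j=1}^d\Delta(\mathcal{A}_j,f)\sum_{k=1}^d\Delta(\mathcal{B}_k,f).$$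 Periodic case. For $j=1,\dots,d$: $\mathcal{A}_j^{\mathbb{T}^d}f(x)=\mathrm{e}^{2\pi\mathrm{i}x_j}f(x)$ on $L_2(\mathbb{T}^d)$, $\mathcal{B}_j^{\mathbb{T}^d}f(x)=\frac{\mathrm{i}}{2\pi}\frac{\partial f}{\partial x_j}(x)$ on $H^1(\mathbb{T}^d)$. For $f\in H^1(\mathbb{T}^d)$ with $\langle\mathcal{A}_j^{\mathbb{T}^d}f,f\rangle_{\mathbb{T}^d}\neq0$ for all $j=1,\dots,d$, $$\mathrm{UP}_{\mathrm{GG}}^{\mathbb{T}^d}(f)=\frac{\sum_{j=1}^d\left(\|f\|_{\mathbb{T}^d}^4-|\langle\mathcal{A}_j^{\mathbb{T}^d}f,f\rangle_{\mathbb{T}^d}|^2\right)}{\left(\sum_{j=1}^d|\langle\mathcal{A}_j^{\mathbb{T}^d}f,f\rangle_{\mathbb{T}^d}|\right)^2}\;\sum_{j=1}^d\left(\frac{\|\mathcal{B}_j^{\mathbb{T}^d}f\|_{\mathbb{T}^d}^2}{\|f\|_{\mathbb{T}^d}^2}-\frac{|\langle\mathcal{B}_j^{\mathbb{T}^d}f,f\rangle_{\mathbb{T}^d}|^2}{\|f\|_{\mathbb{T}^d}^4}\right).$$ Admissibility. A non-zero $f\in L_2(\mathbb{R}^d)$ is admissible if $f$ is continuously differentiable, $f\in H^1(\mathbb{R}^d)$, $\widehat f\in H^1(\mathbb{R}^d)$, and there are constants $C_1,C_2>0$, $\beta>d$, $\gamma>\max\{\frac d2+1,d\}$ such that $|f(x)|\le\frac{C_1}{\|x\|^\gamma}$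 and $\left|\frac{\partial f}{\partial x_j}(x)\right|\le\frac{C_2}{\|x\|^\beta}$, $j=1,\dots,d$, for all $x\in\mathbb{R}^d$ (with $x\neq0$). Periodization. $f_\lambda^{\mathrm{per}}(x)=\sqrt{\lambda^d}\sum_{k\in\mathbb{Z}^d}f(\lambda(x+k))$. The limit is understood for $\lambda$ large enough that $\mathrm{UP}_{\mathrm{GG}}^{\mathbb{T}^d}(f_\lambda^{\mathrm{per}})$ is defined. *)

(* Defs.v *)
From HB Require Import structures.
From mathcomp Require Import all_boot all_order all_algebra.
From mathcomp Require Import complex.
From mathcomp Require Import all_classical all_reals all_analysis.

Set Implicit Arguments.
Unset Strict Implicit.
Unset Printing Implicit Defensive.

Import Order.TTheory GRing.Theory Num.Theory.
Import numFieldNormedType.Exports Normc.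

Local Open Scope classical_set_scope.
Local Open Scope ring_scope.

(* Points of R^d are row vectors.  The library has neither the R-normed        *)
(* topology on R[i] nor complex-valued integrals, so derivatives, integrals    *)
(* and series of complex functions are taken on real and imaginary parts.      *)

Section measurable_rV.
Context {R : realType}.
Variable n : nat.

Let coord (i : 'I_n) (x : 'rV[R]_n) : measurableTypeR R := x ord0 i.

Let rV_set0 : g_sigma_preimage coord set0.
Proof. exact: sigma_algebra0. Qed.

Let rV_setC A : g_sigma_preimage coord A -> g_sigma_preimage coord (~` A).
Proof. exact: sigma_algebraC. Qed.

Let rV_bigcup (F : (set 'rV[R]_n)^nat) :
  (forall i, g_sigma_preimage coord (F i)) ->
  g_sigma_preimage coord (\bigcup_i (F i)).
Proof. exact: sigma_algebra_bigcup. Qed.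

Definition rV_display : measure_display. Proof. by []. Qed.

(* The sigma-algebra generated by the coordinates, i.e. the Borel sets. *)
HB.instance Definition _ := @isMeasurable.Build rV_display 'rV[R]_n
  (g_sigma_preimage coord) rV_set0 rV_setC rV_bigcup.

Lemma measurable_coord (i : 'I_n) :
  measurable_fun [set: 'rV[R]_n] (fun x => x ord0 i : measurableTypeR R).
Proof.
move=> _ Y mY; rewrite setTI; apply: sub_sigma_algebra => /=.
rewrite -bigcup_seq/=; exists i => /=; first by rewrite mem_index_enum.
by exists Y => //; rewrite setTI.
Qed.

Lemma measurable_fun_rV d (T : measurableType d) (f : T -> 'rV[R]_n) :
  (forall i, measurable_fun [set: T] (fun t => f t ord0 i : measurableTypeR R)) ->
  measurable_fun [set: T] f.
Proof.
move=> mf; suff sub : g_sigma_preimage (fun i => coord i \o f) `<=` measurable.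
  move=> _ A mA; apply: sub; rewrite (g_sigma_preimage_comp coord f).
  by exists A.
apply: smallest_sub; first exact: sigma_algebra_measurable.
rewrite -bigcup_seq; apply: bigcup_sub => i _ A [B mB <-].
exact: mf.
Qed.

End measurable_rV.

Section lebesgue_rV.
Context {R : realType}.

Definition rV_cons n (p : measurableTypeR R * 'rV[R]_n) : 'rV[R]_n.+1 :=
  \row_i (if unlift ord0 i is Some j then p.2 ord0 j else p.1).

Lemma measurable_rV_cons n : measurable_fun setT (@rV_cons n).
Proof.
apply: measurable_fun_rV => i; case: (unliftP ord0 i) => [j|] ->.
- rewrite (_ : (fun t => _) = (fun x : 'rV[R]_n => x ord0 j) \o snd).
    exact: (measurableT_comp (measurable_coord j) measurable_snd).
  by apply/funext => t; rewrite mxE liftK.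
- rewrite (_ : (fun t => _) = fst); first exact: measurable_fst.
  by apply/funext => t; rewrite mxE unlift_none.
Qed.

Lemma measurable_rV_behead n :
  measurable_fun [set: 'rV[R]_n.+1]
    (fun x => \row_j x ord0 (lift ord0 j) : 'rV[R]_n).
Proof.
apply: measurable_fun_rV => j.
under eq_fun do rewrite mxE.
exact: measurable_coord.
Qed.

Section step.
Variables (n : nat) (mu : {sigma_finite_measure set 'rV[R]_n -> \bar R}).

Definition lebesgue_step : set 'rV[R]_n.+1 -> \bar R :=
  pushforward (@lebesgue_measure R \x mu)%E (@rV_cons n).

Let pushm : {measure set 'rV[R]_n.+1 -> \bar R} :=
  measure_function_pushforward__canonical__measure_function_Measure
    (@lebesgue_measure R \x mu)%E (@measurable_rV_cons n).

HB.instance Definition _ := Measure.copy lebesgue_step pushm.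

Let step_sigma_finite : sigma_finite setT lebesgue_step.
Proof.
have /sigma_finiteP[F [TF ndF Foo]] := sigma_finiteT (@lebesgue_measure R).
have /sigma_finiteP[G [TG ndG Goo]] := sigma_finiteT mu.
pose hd (x : 'rV[R]_n.+1) : measurableTypeR R := x ord0 ord0.
pose tl (x : 'rV[R]_n.+1) : 'rV[R]_n := \row_j x ord0 (lift ord0 j).
exists (fun k => hd @^-1` F k `&` tl @^-1` G k) => [|k].
  apply/seteqP; split => // x _.
  have [i _ Fi] : (\bigcup_k F k) (hd x) by rewrite -TF.
  have [j _ Gj] : (\bigcup_k G k) (tl x) by rewrite -TG.
  exists (maxn i j) => //; split => /=.
  - by move: (hd x) Fi; exact/subsetPset/ndF/leq_maxl.
  - by move: (tl x) Gj; exact/subsetPset/ndG/leq_maxr.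
have [mF Fk] := Foo k; have [mG Gk] := Goo k; split.
  apply: measurableI; rewrite -[X in measurable X]setTI.
  - exact: measurable_coord.
  - exact: measurable_rV_behead.
rewrite /lebesgue_step /pushforward.
rewrite (_ : _ @^-1` _ = F k `*` G k); last first.
  apply/seteqP; split => -[a y]; rewrite /= /hd mxE unlift_none => -[Fa];
    rewrite (_ : tl _ = y) ?mxE//;
    by apply/rowP => j; rewrite !mxE liftK.
by rewrite product_measure1E// lte_mul_pinfty// ge0_fin_numE.
Qed.

HB.instance Definition _ := Measure_isSigmaFinite.Build _ _ _ lebesgue_step
  step_sigma_finite.

End step.

Fixpoint lebesgue_rV n : {sigma_finite_measure set 'rV[R]_n -> \bar R} :=
  if n is m.+1 then lebesgue_step (lebesgue_rV m) else \d_(0 : 'rV[R]_0).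

End lebesgue_rV.

Section calculus.
Context {R : realType} {d : nat}.
Local Notation C := R[i].
Local Notation V := 'rV[R]_d.
Local Notation mu := (@lebesgue_rV R d).
Implicit Types (f g : V -> C) (phi : V -> R) (D : set V) (x : V) (j : 'I_d).

Definition dot (x y : V) : R := \sum_j x ord0 j * y ord0 j.

(* The norm [`|x|] of the library is the sup norm on row vectors. *)
Definition enorm x : R := Num.sqrt (dot x x).

Definition expi (t : R) : C := (cos t +i* sin t)%C.

Definition re f x : R := complex.Re (f x).
Definition im f x : R := complex.Im (f x).

Definition cintegral D f : C :=
  (Rintegral mu D (re f) +i* Rintegral mu D (im f))%C.

Definition inner D f g : C := cintegral D (fun x => f x * (g x)^*%C).

Definition norm2 D f : R := Num.sqrt (Rintegral mu D (fun x => normc (f x) ^+ 2)).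

Definition L2 D : set (V -> C) :=
  [set f | [/\ measurable_fun D (re f), measurable_fun D (im f) &
    (\int[mu]_(x in D) (normc (f x) ^+ 2)%:E < +oo)%E]].

Definition fourier f (xi : V) : C :=
  cintegral setT (fun x => f x * expi (- (2 * pi * dot x xi))).

Definition partial j phi x : R := 'D_(delta_mx ord0 j : V) phi x.

Definition cpartial j f x : C := (partial j (re f) x +i* partial j (im f) x)%C.

Definition C1 phi :=
  (forall x, differentiable phi x) /\ forall j, continuous (partial j phi).

Definition cC1 f := C1 (re f) /\ C1 (im f).

Definition smooth phi :=
  forall (s : seq 'I_d) x, differentiable (foldr partial phi s) x.

Definition of_Zd (k : 'rV[int]_d) : V := map_mx intr k.

Definition periodic (T : Type) (f : V -> T) :=
  forall (k : 'rV[int]_d) x, f (x + of_Zd k) = f x.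

(* Functions on the torus R^d / Z^d are periodic functions on R^d, integrated  *)
(* over the fundamental domain [-1/2, 1/2)^d.                                  *)
Variant setting := Euclid | Torus.

Definition dom (s : setting) : set V :=
  match s with
  | Euclid => setT
  | Torus => [set x | forall j, - 2^-1 <= x ord0 j < 2^-1]
  end.

Definition L2on (s : setting) : set (V -> C) :=
  match s with
  | Euclid => L2 (dom Euclid)
  | Torus => [set f | periodic f /\ L2 (dom Torus) f]
  end.

Definition test (s : setting) : set (V -> R) :=
  [set phi | smooth phi /\
    match s with
    | Euclid => compact (closure [set x | phi x != 0])
    | Torus => periodic phi
    end].

Definition weak_partial (s : setting) j f g :=
  forall phi, test s phi ->
    cintegral (dom s) (fun x => f x * (partial j phi x)%:C%C) =
    - cintegral (dom s) (fun x => g x * (phi x)%:C%C).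

Definition H1 (s : setting) : set (V -> C) :=
  [set f | L2on s f /\ forall j, exists2 g, L2on s g & weak_partial s j f g].

(* The j-th first-order derivative of an element of H1.  A weak derivative is  *)
(* determined only up to a null set; for continuously differentiable functions *)
(* the representative taken is the pointwise partial derivative.               *)
Definition deriv_rep (s : setting) j f : V -> C :=
  if `[< cC1 f >] then cpartial j f
  else xget (fun=> 0) [set g | L2on s g /\ weak_partial s j f g].

Definition opB (s : setting) j f x : C :=
  (0 +i* (2 * pi)^-1)%C * deriv_rep s j f x.

Definition opA j f x : C := (2 * pi * x ord0 j)%:C%C * f x.

Definition opAT j f x : C := expi (2 * pi * x ord0 j) * f x.

Definition dispersion (A : (V -> C) -> V -> C) f : R :=
  norm2 (dom Euclid) (A f) ^+ 2
  - normc (inner (dom Euclid) (A f) f) ^+ 2 / norm2 (dom Euclid) f ^+ 2.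

Definition UP f : R :=
  (d%:R ^+ 2 * norm2 (dom Euclid) f ^+ 4)^-1
  * (\sum_j dispersion (opA j) f) * (\sum_k dispersion (opB Euclid k) f).

(* The domain of [UPT]. *)
Definition UPT_defined f :=
  H1 Torus f /\ forall j, inner (dom Torus) (opAT j f) f != 0.

Definition UPT f : R :=
  (\sum_j (norm2 (dom Torus) f ^+ 4
           - normc (inner (dom Torus) (opAT j f) f) ^+ 2))
  / (\sum_j normc (inner (dom Torus) (opAT j f) f)) ^+ 2
  * (\sum_j (norm2 (dom Torus) (opB Torus j f) ^+ 2 / norm2 (dom Torus) f ^+ 2
             - normc (inner (dom Torus) (opB Torus j f) f) ^+ 2
               / norm2 (dom Torus) f ^+ 4)).

Definition admissible f :=
  [/\ L2on Euclid f,
      ~ {ae mu, forall x, f x = 0},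
      cC1 f,
      H1 Euclid f /\ H1 Euclid (fourier f) &
      exists c1 c2 beta gamma : R,
        [/\ 0 < c1, 0 < c2, d%:R < beta, Num.max (d%:R / 2 + 1) d%:R < gamma &
          forall x, x != 0 ->
            normc (f x) <= c1 / enorm x `^ gamma /\
            forall j, normc (cpartial j f x) <= c2 / enorm x `^ beta]].

(* The sum of an absolutely summable family indexed by Z^d. *)
Definition lattice_sum (a : 'rV[int]_d -> R) : R :=
  fine (\esum_(k in [set: 'rV[int]_d]) (EFin \o a)^\+ k
        - \esum_(k in [set: 'rV[int]_d]) (EFin \o a)^\- k)%E.

Definition clattice_sum (a : 'rV[int]_d -> C) : C :=
  (lattice_sum (fun k => complex.Re (a k))
   +i* lattice_sum (fun k => complex.Im (a k)))%C.

Definition periodize (lam : R) f x : C :=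
  (Num.sqrt (lam ^+ d))%:C%C * clattice_sum (fun k => f (lam *: (x + of_Zd k))).

End calculus.

(* Main.v *)
Require Import Defs.
From HB Require Import structures.
From mathcomp Require Import all_boot all_order all_algebra.
From mathcomp Require Import complex ring lra.
From mathcomp Require Import all_classical all_reals all_analysis.
From mathcomp Require Import measurable_realfun.
Set Implicit Arguments.
Unset Strict Implicit.
Unset Printing Implicit Defensive.
Import Order.TTheory GRing.Theory Num.Theory.
Import numFieldNormedType.Exports Normc.
Import Defs.
Local Open Scope classical_set_scope.
Local Open Scope ring_scope.

(** Put w = |P|^2, where P is the periodization with parameter lam, and rescale
    the torus by y = lam x.  Integrals over the torus become integrals over the
    cube of side lam, and P becomes, up to the factor lam^(d/2) that the change
    of variables absorbs, the sum F of all translates f(y + lam k) over the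
    lattice.  As lam grows, F tends pointwise to f.

    The domination comes from the choice of the fundamental cube: if
    |y| <= lam/2 and k is not 0, then |y + lam k| >= lam |k| / 2, so that
    1 + |y + lam k| is at least (1 + |y|)(1 + |k|)/6 (psi_cell).  Since the
    powers (1 + |k|)^-s with s > d are summable over the lattice (esum_psi), F
    is bounded on the whole cube by a multiple of (1 + |y|)^-gamma with a
    constant independent of lam, and its derivatives by a multiple of
    (1 + |y|)^-beta.  Dominated convergence (cvg_torus_integral) then gives the
    limits of all the moments involved.

    The angular factor of the product has to be multiplied by lam^2, the other
    one being divided by it.  With N the integral of w, C and S the integrals of
    cos(2 pi x_j) w and sin(2 pi x_j) w,
      lam^2 (N^2 - C^2 - S^2) = lam^2 (N - C) (N + C) - (lam S)^2,
    and lam^2 (1 - cos) and lam sin tend to (2 pi y_j)^2 / 2 and 2 pi y_j and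
    grow at most like |y|^2 and |y|; the hypothesis gamma > d/2 + 1 is exactly
    what makes |y|^2 (1 + |y|)^(-2 gamma) integrable.  The limit is the position
    variance times the square of the norm (cvg_angular_variance).  The frequency
    factor is a limit of the same kind (cvg_frequency_variance).

    It remains to know that P is a legitimate argument of the periodic product.
    The lattice sum is differentiated term by term (lattice_sum_C1), hence P is
    continuously differentiable and its derivatives are the classical ones; the
    integration by parts that identifies them with weak derivatives is the
    vanishing of the integral of a partial derivative of a periodic function
    (integral_torus_partial). *)

(** * Borel sets and iterated integrals on R^n *)

Section measurability.
Context {R : realType} {n : nat}.
Local Notation V := 'rV[R]_n.

Lemma coord_le_norm (x : V) i : `|x ord0 i| <= `|x|.
Proof.
rewrite [leRHS]/Num.norm /= mx_normrE; apply/bigmax_geP; right => /=.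
by exists (ord0, i).
Qed.

Lemma norm_rV_le (x : V) r : 0 <= r -> (forall i, `|x ord0 i| <= r) -> `|x| <= r.
Proof.
move=> r0 xr; rewrite [leLHS]/Num.norm /= mx_normrE; apply/bigmax_leP; split=> //.
by move=> [i j] _ /=; rewrite (ord1 i).
Qed.

(** The sigma-algebra at hand is generated by the coordinates, so the topology
    enters through its countable base: an open set is a union of boxes with
    rational centres and radii 1/(m+1). *)
Lemma measurable_open (U : set V) : open U -> measurable U.
Proof.
move=> oU.
pose box (p : 'rV[rat]_n * nat) : set V :=
  [set x | forall i, `|x ord0 i - ratr (p.1 ord0 i)| < p.2.+1%:R^-1].
have mbox p : measurable (box p).
  have -> : box p = \bigcap_(i in [set: 'I_n])
      ((fun x : V => x ord0 i : measurableTypeR R) @^-1`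
        (ball (ratr (p.1 ord0 i) : R) p.2.+1%:R^-1)).
    apply/seteqP; split => x /= xb i.
      by move=> _; have := xb i; rewrite /ball/= distrC.
    by have := xb i I; rewrite /ball/= distrC.
  apply: fin_bigcap_measurable => // i _; rewrite -[X in measurable X]setTI.
  by apply: measurable_coord => //; rewrite ball_itv; exact: measurable_itv.
have -> : U = \bigcup_k (if unpickle k is Some p then
    if `[< box p `<=` U >] then box p else set0 else set0).
  apply/seteqP; split => [x Ux|x [k _]]; last first.
    by case: unpickle => // p; case: asboolP => // pU /pU.
  have := oU; rewrite openE => /(_ _ Ux); rewrite /interior => /nbhs_ballP[e /= e0 xe].
  have [m me] : exists m : nat, m.+1%:R^-1 < e / 2.
    exists (Num.truncn (e / 2)^-1).
    rewrite -ltf_pV2 ?posrE ?divr_gt0// invrK.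
    exact: truncnS_gt.
  have qx i : exists q : rat, `|x ord0 i - ratr q| < m.+1%:R^-1.
    have := me; set u := m.+1%:R^-1; move=> _.
    have /rat_in_itvoo[q] : x ord0 i - u < x ord0 i + u.
      by rewrite ltrD2l gtrN// invr_gt0.
    by rewrite in_itv/= => /andP[q1 q2]; exists q; rewrite ltr_norml; apply/andP; split; lra.
  have [q qxi] := choice qx.
  pose p := (\row_i q i, m).
  exists (pickle p) => //; rewrite pickleK.
  have bx : box p x by move=> i; rewrite mxE.
  case: asboolP => // -[] y ybox; apply: xe; rewrite -ball_normE /ball_ /=.
  rewrite (@le_lt_trans _ _ (2 * m.+1%:R^-1))//; last first.
    by move: me; set u := _^-1; move=> ?; lra.
  apply: norm_rV_le => [|i]; first by rewrite mulr_ge0.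
  have := bx i; have := ybox i; rewrite !mxE /=; set u := m.+1%:R^-1.
  by rewrite !ltr_norml => /andP[? ?] /andP[? ?]; rewrite ler_norml; apply/andP; split; lra.
apply: bigcupT_measurable => k; case: unpickle => // p.
by case: asboolP.
Qed.

Lemma continuous_measurable_rV (f : V -> R) : continuous f ->
  measurable_fun [set: V] f.
Proof.
move=> /continuousP cf _; apply: (measurability _ (RGenOpens.measurableE R)) => //.
by move=> _ [_ [a [b ->] <-]]; rewrite setTI; apply: measurable_open; apply: (cf); apply: interval_open.
Qed.

Lemma measurable_scale (c : R) :
  measurable_fun [set: V] (fun x : V => c *: x : V).
Proof.
apply: measurable_fun_rV => i; under eq_fun do rewrite mxE.
by apply: measurableT_comp; [exact: mulrl_measurable|exact: measurable_coord].
Qed.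

Lemma continuous_bounded_ball (g : V -> R) (r : R) : continuous g ->
  exists2 M : R, 0 <= M & forall x, `|x| <= r -> `|g x| <= M.
Proof.
move=> cg.
pose K : set V := [set v | forall i, `[- r, r]%classic (v ord0 i)].
have cK : compact K.
  by apply: (@rV_compact R n (fun=> `[- r, r]%classic)) => _; exact: segment_compact.
have : compact (g @` K).
  by apply: continuous_compact => //; exact: continuous_subspaceT.
move/compact_bounded => [M [_ MK]].
exists (`|M| + 1) => [|x xr]; first by rewrite addr_ge0.
apply: MK; first by rewrite (le_lt_trans (ler_norm _))// ltrDl.
exists x => // i /=; rewrite in_itv/= -ler_norml.
exact: le_trans (coord_le_norm _ _) xr.
Qed.

End measurability.

Section integration.
Context {R : realType}.
Local Notation leb := (@lebesgue_measure R).
Local Notation mu n := (@lebesgue_rV R n).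
Local Open Scope ereal_scope.

(** Every integral over R^(n+1) is computed from this recursion, which is how the
    measure itself was built. *)
Lemma integral_rVS n (f : 'rV[R]_n.+1 -> \bar R) :
  measurable_fun [set: 'rV[R]_n.+1] f -> (forall x, 0 <= f x) ->
  \int[mu n.+1]_x f x = \int[leb]_t \int[mu n]_y f (rV_cons (t, y)).
Proof.
move=> mf f0; rewrite /= ge0_integral_pushforward//; last first.
  exact: measurable_rV_cons.
rewrite preimage_setT fubini_tonelli1// => [|x]; last exact: f0.
by apply: measurableT_comp => //; exact: measurable_rV_cons.
Qed.

(** The measure A |-> c |A / c| agrees with Lebesgue measure on half-open
    intervals, hence everywhere. *)
Lemma ge0_integral_scale1 (c : R) (f : R -> \bar R) : (0 < c)%R ->
  measurable_fun setT f -> (forall x, 0 <= f x) ->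
  c%:E * \int[leb]_t f (c * t)%R = \int[leb]_t f t.
Proof.
move=> c0 mf f0.
have mc : measurable_fun setT (fun t : measurableTypeR R => (c * t)%R : measurableTypeR R).
  exact: mulrl_measurable.
pose m : {measure set (measurableTypeR R) -> \bar R} :=
  measure_function_pushforward__canonical__measure_function_Measure leb mc.
pose k : {nonneg R} := NngNum (ltW c0).
rewrite [RHS](@eq_measure_integral _ _ _ _ (mscale k m)); last first.
  move=> A mA _; apply: lebesgue_measure_unique => //.
  move=> _ [[a b]] _ <-; rewrite /mscale/= /pushforward.
  rewrite [X in _ = _ * lebesgue_measure X](_ : _ = `](a / c)%R, (b / c)%R]%classic); last first.
    apply/seteqP; split => x /=; rewrite !in_itv/=;
    by rewrite ltr_pdivrMr// ler_pdivlMr// (mulrC x).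
  rewrite !lebesgue_measure_itv/= !lte_fin ltr_pM2r ?invr_gt0//.
  case: ifP => _; last by rewrite mule0.
  by rewrite -EFinB -EFinM -mulrBl mulrCA divff ?mulr1// gt_eqF.
rewrite ge0_integral_mscale//; congr (_ * _).
by rewrite ge0_integral_pushforward// preimage_setT.
Qed.

Lemma ge0_integral_scale n (c : R) (f : 'rV[R]_n -> \bar R) : (0 < c)%R ->
  measurable_fun [set: 'rV[R]_n] f -> (forall x, 0 <= f x) ->
  (c ^+ n)%:E * \int[mu n]_x f (c *: x) = \int[mu n]_x f x.
Proof.
move=> c0; elim: n f => [|n IH] f mf f0.
  rewrite expr0 mul1e; apply: eq_integral => x _; congr (f _).
  by apply/rowP => -[].
have mp1 t : measurable_fun [set: 'rV[R]_n] (fun y : 'rV[R]_n => f (rV_cons (t, y))).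
  apply: measurableT_comp => //; apply: measurableT_comp.
    exact: measurable_rV_cons.
  exact: measurable_pair1.
rewrite !integral_rVS//; last exact: (measurableT_comp mf (measurable_scale c (n := n.+1))).
have E t (y : 'rV[R]_n) : c *: rV_cons (t, y) = rV_cons (c * t, c *: y)%R.
  by apply/rowP => i; rewrite !mxE; case: unliftP => [j|] _ //=; rewrite mxE.
under eq_integral do under eq_integral do rewrite E.
rewrite exprS EFinM -muleA -ge0_integralZl//; first last.
- by rewrite lee_fin exprn_ge0// ltW.
- by move=> t _; exact: integral_ge0.
- rewrite (_ : (fun t => _) = fubini_F (mu n) (fun p : measurableTypeR R * 'rV[R]_n =>
     f (rV_cons (c * p.1, c *: p.2)%R)))//.
  apply: measurable_fun_fubini_tonelli_F => //.
  apply: measurableT_comp => //; apply: measurableT_comp.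
    exact: measurable_rV_cons.
  apply: measurable_fun_pair.
    exact: (measurableT_comp (mulrl_measurable c) measurable_fst).
  exact: (measurableT_comp (measurable_scale c (n := n)) measurable_snd).
under eq_integral => t _ do
  rewrite (IH (fun y => f (rV_cons (c * t, y)%R)) (mp1 (c * t)%R) (fun=> f0 _)).
rewrite (@ge0_integral_scale1 c (fun t => \int[mu n]_y f (rV_cons (t, y))))//.
  rewrite (_ : (fun t => _) = fubini_F (mu n) (f \o @rV_cons R n))//.
  apply: measurable_fun_fubini_tonelli_F => [|x]; last exact: f0.
  by apply: measurableT_comp => //; exact: measurable_rV_cons.
by move=> x; apply: integral_ge0 => y _; exact: f0.
Qed.

Lemma integral_scale n (c : R) (f : 'rV[R]_n -> \bar R) : (0 < c)%R ->
  measurable_fun [set: 'rV[R]_n] f ->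
  \int[mu n]_x ((c ^+ n)%:E * f (c *: x)) = \int[mu n]_x f x.
Proof.
move=> c0 mf; rewrite [RHS]integralE [LHS]integralE.
have cn0 : (0 <= c ^+ n)%R by rewrite exprn_ge0// ltW.
congr (_ - _).
- rewrite -[RHS](ge0_integral_scale c0)//; last exact: measurable_funepos.
  rewrite -ge0_integralZl//.
  + apply: eq_integral => x _.
    by rewrite !funeposE maxe_pMr// mule0.
  + exact: (measurableT_comp (measurable_funepos mf) (measurable_scale c (n := n))).
- rewrite -[RHS](ge0_integral_scale c0)//; last exact: measurable_funeneg.
  rewrite -ge0_integralZl//.
  + apply: eq_integral => x _.
    by rewrite !funenegE -muleN maxe_pMr// mule0.
  + exact: (measurableT_comp (measurable_funeneg mf) (measurable_scale c (n := n))).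
Qed.

End integration.

(** * Power weights *)

Lemma continuous_japanese (R : realType) (V : normedModType R) (r : R) :
  continuous (fun x : V => (1 + `|x|) `^ r).
Proof.
move=> x; apply: (@continuous_comp _ _ _ (fun x : V => 1 + `|x|) (@powR R ^~ r)).
  by apply: cvgD; [exact: cvg_cst|exact: norm_continuous].
apply: differentiable_continuous; apply/derivable1_diffP.
have x1 : 0 < 1 + `|x| by rewrite ltr_pwDl.
by have [] := @is_derive1_powR R r (1 + `|x|) x1.
Qed.

Lemma cvg_powRN_pinfty (R : realType) (q : R) : 0 < q ->
  x `^ (- q) @[x --> +oo] --> (0 : R).
Proof.
move=> q0; apply/cvgr0Pnorm_lt => e e0; near=> x.
have xe : (e `^ - q^-1) < x by near: x; apply: nbhs_pinfty_gt; rewrite num_real.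
have x0 : 0 < x by rewrite (le_lt_trans _ xe)// powR_ge0.
rewrite ger0_norm ?powR_ge0// powRN -[e]invrK ltf_pV2 ?posrE ?powR_gt0 ?invr_gt0//.
rewrite -powR_inv1 ?(ltW e0)// (_ : -1 = - q^-1 * q :> R).
  by rewrite powRrM gt0_ltr_powR// nnegrE ?powR_ge0// ltW.
by rewrite mulNr mulVf// gt_eqF.
Unshelve. all: by end_near. Qed.

Section products.
Context {R : realType}.
Local Notation leb := (@lebesgue_measure R).
Local Notation mu n := (@lebesgue_rV R n).
Local Open Scope ereal_scope.

Lemma measurable_prod_coord n (phi : 'I_n -> R -> R) :
  (forall i, measurable_fun setT (phi i)) ->
  measurable_fun [set: 'rV[R]_n] (fun x => \prod_i phi i (x ord0 i))%R.
Proof.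
move=> mphi; apply: measurable_prod => i _.
exact: (measurableT_comp (mphi i) (measurable_coord i)).
Qed.

(** Used twice: for indicator functions it gives the volume of a cube, and for
    powers of 1 + |t| the integrability of the weights below. *)
Lemma integral_prod_coord n (phi : 'I_n -> R -> R) :
  (forall i, measurable_fun setT (phi i)) -> (forall i t, 0 <= phi i t)%R ->
  \int[mu n]_x (\prod_i phi i (x ord0 i))%:E =
  \big[mule/1]_i \int[leb]_t (phi i t)%:E.
Proof.
elim: n phi => [|n IH] phi mphi phi0.
  under eq_integral do rewrite big_ord0.
  by rewrite big_ord0 integral_cst//= diracT mul1e.
rewrite integral_rVS; first last.
- by move=> x; rewrite lee_fin prodr_ge0.
- by apply/measurable_EFinP; exact: measurable_prod_coord.
transitivity (\int[leb]_t ((phi ord0 t)%:E *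
    \int[mu n]_y (\prod_i phi (lift ord0 i) (y ord0 i))%:E)).
  apply: eq_integral => t _; rewrite -ge0_integralZl//; first last.
  - by rewrite lee_fin.
  - by move=> x _; rewrite lee_fin prodr_ge0.
  - apply/measurable_EFinP.
    by apply: (@measurable_prod_coord _ (fun i => phi (lift ord0 i))).
  apply: eq_integral => y _; rewrite -EFinM big_ord_recl; congr (_ * _)%:E%R.
    by rewrite mxE unlift_none.
  by apply: eq_bigr => i _; rewrite mxE liftK.
rewrite ge0_integralZr//; first last.
- by apply: integral_ge0 => y _; rewrite lee_fin prodr_ge0.
- by move=> t _; rewrite lee_fin.
- by apply/measurable_EFinP; exact: (mphi ord0).
by rewrite (IH (fun i => phi (lift ord0 i)))// [RHS]big_ord_recl.
Qed.

Lemma integral_japanese1 (p : R) : (1 < p)%R ->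
  \int[leb]_t ((1 + `|t|) `^ (- p))%:E < +oo.
Proof.
move=> p1; set f := fun t : R => ((1 + `|t|) `^ (- p))%R.
have mf : measurable_fun setT f.
  apply: (measurableT_comp (measurable_powR (- p))).
  by apply: measurable_funD => //.
have half : \int[leb]_(t in `[0%R, +oo[) (f t)%:E < +oo.
  (* an antiderivative of (1 + t)^-p on the half line, vanishing at infinity *)
  pose F t : R := (- ((1 + t) `^ (1 - p)) / (p - 1))%R.
  have dF (t : R) : (0 <= t)%R -> is_derive t (1%R : R) F ((1 + t) `^ (- p))%R.
    move=> t0.
    have t1 : (0 < 1 + t)%R by rewrite ltr_pwDl.
    have := @is_derive1_powR R (1 - p) (1 + t) t1.
    move=> D1.
    have D2 : is_derive t (1%R : R) (fun t : R => (1 + t)%R) 1%R.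
      have := @is_deriveD _ _ _ (cst (1%R : R)) id t 1%R _ _ (is_derive_cst _ _ _) (is_derive_id _ _).
      by rewrite add0r.
    have D3 := is_derive1_comp D1 D2.
    rewrite (_ : F = (- (p - 1)^-1)%R *: (@powR R ^~ (1 - p) \o (fun t => 1 + t))%R); last first.
      by apply/funext => u; rewrite /F !fctE /GRing.scale /= mulrC mulrN mulNr.
    apply: is_derive_eq; rewrite mulr1 (_ : 1 - p - 1 = - p)%R; last by ring.
    rewrite /GRing.scale/= mulrA mulNr -mulrN opprB mulVf ?mul1r//.
    by rewrite subr_eq0 gt_eqF.
  rewrite (@ge0_continuous_FTC2y _ _ F 0 0).
  - by rewrite /F ltry.
  - by move=> x _; exact: powR_ge0.
  - by apply: continuous_subspaceT; exact: continuous_japanese.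
  - rewrite -[X in _ --> X](mulr0 (- (p - 1)^-1))%R.
    rewrite (_ : F = (fun t => - (p - 1)^-1 * (1 + t) `^ (- (p - 1)))%R); last first.
      by apply/funext => u; rewrite /F opprB mulrC mulrN mulNr.
    apply: cvgMr.
    have c1 : (1 + t : R)%R @[t --> +oo%R] --> +oo%R.
      apply/cvgryPge => A; near=> t.
      have : (A <= t)%R by near: t; apply: nbhs_pinfty_ge; rewrite num_real.
      by move/le_trans; apply; rewrite lerDr.
    have p10 : (0 < p - 1)%R by rewrite subr_gt0.
    exact: (cvg_comp _ _ c1 (cvg_powRN_pinfty p10)).
  - by move=> x x0; have [] := dF _ (ltW x0).
  - apply: cvg_at_right_filter; apply: differentiable_continuous.
    by apply/derivable1_diffP; have [] := dF 0%R (lexx _).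
  - move=> x; rewrite in_itv/= andbT => x0.
    by rewrite derive1E /f ger0_norm ?(ltW x0)//; have [_ ->] := dF _ (ltW x0).
rewrite ge0_symfun_integralT//=.
- rewrite -set_itvcy; apply: lte_mul_pinfty => //.
- exact: continuous_japanese.
- by move=> x; rewrite /f /= normrN.
Unshelve. all: by end_near. Qed.

End products.

(** The norm is the sup norm, for which the weight is comparable with products
    over the coordinates; the Euclidean norm dominates it.  Negative exponents s
    are used as well: they measure polynomial growth. *)
Definition psi {R : realType} n (s : R) (x : 'rV[R]_n) : R := (1 + `|x|) `^ (- s).

Section psi.
Context {R : realType} {n : nat}.
Hypothesis n0 : (0 < n)%N.
Local Notation V := 'rV[R]_n.
Local Notation mu := (@lebesgue_rV R n).
Implicit Types (x y : V) (s : R).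

Lemma psi_ge0 s x : 0 <= psi s x. Proof. exact: powR_ge0. Qed.

Lemma psi_le_scale s (c : R) x y : 0 <= s -> 0 < c ->
  c * (1 + `|y|) <= 1 + `|x| -> psi s x <= c `^ (- s) * psi s y.
Proof.
move=> s0 c0 cyx; rewrite /psi -powRM ?addr_ge0 ?(ltW c0)//.
have cy0 : 0 < c * (1 + `|y|) by rewrite mulr_gt0// ltr_pwDl.
rewrite !powRN lef_pV2 ?posrE ?powR_gt0//.
by rewrite ge0_ler_powR// nnegrE ?addr_ge0// (ltW cy0).
Qed.

(** Each factor 1 + |x_i| is at most 1 + |x|, so spreading the exponent evenly
    over the n coordinates reduces integrability in dimension n to the exponent
    s/n > 1 on the line. *)
Lemma psi_le_prod s x : 0 <= s ->
  psi s x <= \prod_i (1 + `|x ord0 i|) `^ (- (s / n%:R)).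
Proof.
move=> s0; have nR : n%:R != 0 :> R by rewrite pnatr_eq0 -lt0n.
have -> : psi s x = \prod_(i < n) (1 + `|x|) `^ (- (s / n%:R)).
  rewrite prodr_const card_ord -powR_mulrn ?powR_ge0// -powRrM.
  by rewrite mulNr divfK.
apply: ler_prod => i _; rewrite powR_ge0/= !powRN.
rewrite lef_pV2 ?posrE ?powR_gt0 ?ltr_pwDl//.
rewrite ge0_ler_powR ?nnegrE ?addr_ge0 ?divr_ge0//.
by rewrite lerD2l coord_le_norm.
Qed.

Lemma measurable_psi s : measurable_fun [set: V] (psi s).
Proof. by apply: continuous_measurable_rV; exact: continuous_japanese. Qed.

Lemma integral_psi s : n%:R < s -> (\int[mu]_x (psi s x)%:E < +oo)%E.
Proof.
move=> ns; have s0 : 0 < s by rewrite (le_lt_trans _ ns).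
have nR : 0 < n%:R :> R by rewrite ltr0n.
pose phi (t : R) := (1 + `|t|) `^ (- (s / n%:R)).
have mphi : measurable_fun setT phi.
  by apply: continuous_measurable_fun; exact: continuous_japanese.
apply: (@le_lt_trans _ _ (\int[mu]_x (\prod_i phi (x ord0 i))%:E)%E).
  apply: ge0_le_integral => //.
  - by move=> x _; rewrite lee_fin psi_ge0.
  - by apply/measurable_EFinP; exact: measurable_psi.
  - by apply/measurable_EFinP; exact: (measurable_prod_coord (fun=> mphi)).
  - by move=> x _; rewrite lee_fin psi_le_prod// ltW.
rewrite (integral_prod_coord (fun=> mphi)); last by move=> _ t; exact: powR_ge0.
have : (\int[lebesgue_measure]_t (phi t)%:E < +oo)%E.
  by apply: integral_japanese1; rewrite ltr_pdivlMr// mul1r.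
have : (0 <= \int[lebesgue_measure]_t (phi t)%:E)%E.
  by apply: integral_ge0 => t _; rewrite lee_fin powR_ge0.
move: (\int[_]_t _)%E => I I0 Ioo.
have If : I \is a fin_num by rewrite ge0_fin_numE.
rewrite -(fineK If) (_ : \big[_/_]_(_ < _) _ = (\prod_(i < n) fine I)%:E) ?ltry//.
by elim: n => [|m IH]; rewrite ?big_ord0// !big_ord_recl IH EFinM.
Qed.

Lemma integrable_psi s : n%:R < s -> mu.-integrable setT (EFin \o psi s).
Proof.
move=> ns; apply/integrableP; split.
  by apply/measurable_EFinP; exact: measurable_psi.
under eq_integral do rewrite /= ger0_norm ?psi_ge0//.
exact: integral_psi.
Qed.

(** The translates of the fundamental domain by the lattice, which tile the space. *)
Definition cube (k : 'rV[int]_n) : set V :=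
  [set x | forall j, (k ord0 j)%:~R - 2^-1 <= x ord0 j < (k ord0 j)%:~R + 2^-1].

Lemma cubeE k x : cube k x <-> k = \row_j Num.floor (x ord0 j + 2^-1).
Proof.
split=> [kx|-> j].
  apply/rowP => j; rewrite mxE; apply/esym/eqP; rewrite floor_eq.
  by have /andP[k1 k2] := kx j; apply/andP; split; rewrite ?intrD; lra.
rewrite mxE; have /andP[k1 k2] := floor_itv (x ord0 j + 2^-1).
by move: k2; rewrite intrD => k2; apply/andP; split; lra.
Qed.

Lemma measurable_cube k : measurable (cube k).
Proof.
have -> : cube k = \bigcap_(i in [set: 'I_n])
      ((fun x : V => x ord0 i : measurableTypeR R) @^-1`
        `[(k ord0 i)%:~R - 2^-1, (k ord0 i)%:~R + 2^-1[%classic).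
  apply/seteqP; split => x /= xb i.
    by move=> _ /=; rewrite in_itv/=; exact: xb.
  by have /= := xb i I; rewrite in_itv.
apply: fin_bigcap_measurable => // i _; rewrite -[X in measurable X]setTI.
by apply: measurable_coord.
Qed.

Lemma mu_cube k : mu (cube k) = 1%E.
Proof.
pose phi i : R -> R := \1_(`[(k ord0 i)%:~R - 2^-1, (k ord0 i)%:~R + 2^-1[%classic).
have E x : \1_(cube k) x = \prod_i phi i (x ord0 i) :> R.
  rewrite indicE; have [xk|xk] := boolP (x \in cube k).
    rewrite big1// => i _; rewrite /phi indicE mem_set//= in_itv/=.
    by move: xk; rewrite inE => /(_ i).
  have [j xj] : exists j, x ord0 j \notin `[(k ord0 j)%:~R - 2^-1, (k ord0 j)%:~R + 2^-1[.
    apply/existsP; apply: contraNT xk => /existsPn xk; rewrite inE => j.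
    by have := xk j; rewrite negbK in_itv.
  rewrite (bigD1 j)//= /phi indicE memNset ?mul0r//=.
  by move: xj => /negP.
have -> : mu (cube k) = (\int[mu]_x (\1_(cube k) x)%:E)%E.
  by rewrite integral_indic ?setIT//; exact: measurable_cube.
under eq_integral do rewrite E.
rewrite integral_prod_coord; first last.
- by move=> i t; rewrite /phi.
- by move=> i; apply: measurable_indic.
rewrite (eq_bigr (fun=> 1%E)); last first.
  move=> i _; rewrite integral_indic// setIT [LHS]lebesgue_measure_itv/= lte_fin.
  rewrite ltrD2l gtrN ?invr_gt0// -EFinD; congr EFin; lra.
by elim/big_ind : _ => // a b -> ->; rewrite mule1.
Qed.

Lemma of_Zd_cube_psi s k x : 0 <= s -> cube k x ->
  psi s (of_Zd k : V) <= 2 `^ s * psi s x.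
Proof.
move=> s0 kx; have -> : 2 `^ s = 2^-1 `^ (- s) :> R.
  by rewrite -powR_inv1// -powRrM mulrNN mul1r.
apply: psi_le_scale => //; have xk : `|x| <= `|of_Zd k : V| + 2^-1.
  apply: norm_rV_le => [|i]; first by rewrite addr_ge0.
  have := coord_le_norm (of_Zd k : V) i; rewrite mxE.
  move: (`|of_Zd k : V|) => N; have /andP[] := kx i; rewrite !ler_norml.
  by move=> ? ? /andP[? ?]; apply/andP; split; lra.
have := normr_ge0 (of_Zd k : V); move: (`|of_Zd k : V|) xk => N; lra.
Qed.

(** On the unit cube around the lattice point k the weight is at least a constant
    multiple of its value at k, so the sum is bounded by the integral. *)
Lemma esum_psi s : n%:R < s ->
  (\esum_(k in [set: 'rV[int]_n]) (psi s (of_Zd k : V))%:E < +oo)%E.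
Proof.
move=> ns; have s0 : 0 < s by rewrite (le_lt_trans _ ns).
apply: (@le_lt_trans _ _ (\int[mu]_x (2 `^ s * psi s x)%:E)%E); last first.
  under eq_integral do rewrite EFinM.
  rewrite ge0_integralZl//.
  - rewrite lte_mul_pinfty ?lee_fin ?powR_ge0//; exact: integral_psi.
  - by apply/measurable_EFinP; exact: measurable_psi.
  - by move=> x _; rewrite lee_fin psi_ge0.
apply: ub_ereal_sup => _ [A [finA _] <-].
rewrite (_ : (\sum_(k \in A) _ = \int[mu]_x
  (\sum_(k \in A) (psi s (of_Zd k : V) * \1_(cube k) x)%:E))%E); last first.
  rewrite ge0_integral_fsum//; last 2 first.
  - move=> k; apply/measurable_EFinP; apply: measurable_funM => //.
    by apply: measurable_indic; exact: measurable_cube.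
  - by move=> k x _; rewrite lee_fin mulr_ge0// psi_ge0.
  apply: eq_fsbigr => k _; under eq_integral do rewrite EFinM.
  rewrite ge0_integralZl//; first last.
  - by rewrite lee_fin psi_ge0.
  - apply/measurable_EFinP.
    by apply: measurable_indic; exact: measurable_cube.
  rewrite integral_indic//; last exact: measurable_cube.
  by rewrite setIT [X in (_ * X)%E](mu_cube k) mule1.
apply: ge0_le_integral => //.
- by move=> x _; rewrite fsume_ge0// => k _; rewrite lee_fin mulr_ge0// psi_ge0.
- apply: emeasurable_fun_fsum => // k; apply/measurable_EFinP; apply: measurable_funM => //.
  by apply: measurable_indic; exact: measurable_cube.
- by apply/measurable_EFinP; apply: measurable_funM => //; exact: measurable_psi.
move=> x _; rewrite fsbig_finite//= sumEFin lee_fin.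
pose k0 : 'rV[int]_n := \row_j Num.floor (x ord0 j + 2^-1).
(* the cubes being disjoint, only the one containing x contributes *)
have k0x k : \1_(cube k) x = (k == k0)%:R :> R.
  rewrite indicE; congr (_%:R); congr nat_of_bool.
  by apply/idP/eqP; rewrite inE => /cubeE.
under eq_bigr do rewrite k0x.
have [k0A|k0A] := boolP (k0 \in finmap.enum_fset (fset_set A)).
  rewrite (bigD1_seq k0 k0A (finmap.fset_uniq _))/= eqxx mulr1 big1 ?addr0; last first.
    by move=> k /negbTE ->; rewrite mulr0.
  by rewrite of_Zd_cube_psi ?(ltW s0)//; exact/cubeE.
rewrite big1_seq ?mulr_ge0 ?powR_ge0 ?psi_ge0// => k /= kA.
by case: eqP => [kk|_]; rewrite ?mulr0//; move: k0A; rewrite -kk kA.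
Qed.

End psi.

(** * Periodic functions on the torus *)

Section line.
Context {R : realType} {n : nat}.
Local Notation V := 'rV[R]_n.

Lemma is_derive_line (h : V -> R) (x v : V) (t : R) :
  differentiable h (x + t *: v) ->
  is_derive t 1 (fun t => h (x + t *: v)) ('d h (x + t *: v) v).
Proof.
move=> dh; pose l (t : R) := x + t *: v.
have dl : is_diff t l (fun s => s *: v).
  have d2 : is_diff t (fun s : R => s *: v) (fun s => s *: v).
    exact: is_diff_scalel.
  have := is_diffD (is_diff_cst x t) d2.
  by rewrite add0r.
have dhl : is_diff (l t) h ('d h (l t)) by exact: differentiableP.
have dc := is_diff_comp dl dhl.
rewrite (_ : (fun t => _) = h \o l)//.
apply: DeriveDef; first by apply/derivable1_diffP; exact: ex_diff.
by rewrite deriveE ?diff_val /= ?scale1r//; exact: ex_diff.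
Qed.

Lemma continuous_line (x v : V) : continuous (fun t : R => x + t *: v).
Proof.
by move=> t; apply: cvgD; [exact: cvg_cst|apply: cvgZr_tmp; exact: cvg_id].
Qed.

Lemma of_ZdD (k l : 'rV[int]_n) : of_Zd (k + l) = of_Zd k + of_Zd l :> V.
Proof. by apply/rowP => i; rewrite !mxE intrD. Qed.

Lemma dom_torusE : dom Torus = cube 0 :> set V.
Proof.
by apply/seteqP; split => x /= xd j; have := xd j; rewrite mxE sub0r add0r.
Qed.

Lemma measurable_torus : measurable (dom Torus : set V).
Proof. by rewrite dom_torusE; exact: measurable_cube. Qed.

Lemma periodic_bounded (g : V -> R) : continuous g -> periodic g ->
  exists2 M : R, 0 <= M & forall x, `|g x| <= M.
Proof.
move=> cg pg.
have [M M0 gM] := continuous_bounded_ball 2^-1 cg.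
exists M => // x.
pose k : 'rV[int]_n := \row_j Num.floor (x ord0 j + 2^-1).
rewrite -(pg (- k)); apply: gM; apply: norm_rV_le => // i.
have : cube k x by apply/cubeE.
move=> /(_ i) /andP[]; rewrite ler_norml !mxE intrN => k1 k2.
by apply/andP; split; lra.
Qed.

Lemma partial_periodic j (h : V -> R) : periodic h -> periodic (partial j h).
Proof.
move=> ph k x; rewrite /partial /derive.
set v : V := delta_mx ord0 j.
have E : (fun t : R => t^-1 *: ((h \o shift (x + of_Zd k)) (t *: v) - h (x + of_Zd k)))
    = (fun t : R => t^-1 *: ((h \o shift x) (t *: v) - h x)).
  by apply/funext => t /=; rewrite addrA !ph.
by rewrite E.
Qed.

End line.

Section slices.
Context {R : realType}.
Local Notation leb := (@lebesgue_measure R).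
Local Notation mu n := (@lebesgue_rV R n).
Local Notation I := (`[- 2^-1, 2^-1[%classic : set R).
Local Open Scope ereal_scope.

Lemma mu_torus n : mu n (dom Torus) = 1.
Proof. by rewrite dom_torusE mu_cube. Qed.

Lemma leb_I : leb I = 1.
Proof.
rewrite lebesgue_measure_itv/= lte_fin gtrN ?invr_gt0// -EFinD; congr EFin; lra.
Qed.

Lemma torus_cons n t (y : 'rV[R]_n) :
  (\1_(dom Torus) (rV_cons (t, y)) = \1_I t * \1_(dom Torus) y :> R)%R.
Proof.
rewrite !indicE -natrM mulnb; congr (_%:R)%R; congr nat_of_bool.
apply/idP/andP; rewrite !inE /= in_itv/=.
  move=> ty; split=> [|i]; first by have := ty ord0; rewrite mxE unlift_none.
  by have := ty (lift ord0 i); rewrite mxE liftK.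
by move=> [tI yT] i; rewrite mxE; case: unliftP.
Qed.

Lemma integral_torusS n (phi : 'rV[R]_n.+1 -> \bar R) :
  measurable_fun [set: 'rV[R]_n.+1] phi -> (forall x, 0 <= phi x) ->
  \int[mu n.+1]_(x in dom Torus) phi x =
    \int[leb]_(t in I) \int[mu n]_(y in dom Torus) phi (rV_cons (t, y)) /\
  \int[mu n.+1]_(x in dom Torus) phi x =
    \int[mu n]_(y in dom Torus) \int[leb]_(t in I) phi (rV_cons (t, y)).
Proof.
move=> mphi phi0.
pose f (x : 'rV[R]_n.+1) := phi x * (\1_(dom Torus) x)%:E.
have f0 x : 0 <= f x by rewrite mule_ge0// lee_fin.
have mf : measurable_fun [set: 'rV[R]_n.+1] f.
  apply: emeasurable_funM => //; apply/measurable_EFinP.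
  by apply: measurable_indic; exact: measurable_torus.
have mfc : measurable_fun [set: R * 'rV[R]_n] (fun p => f (rV_cons p)).
  by apply: measurableT_comp => //; exact: measurable_rV_cons.
have mphic : measurable_fun [set: R * 'rV[R]_n] (fun p => phi (rV_cons p)).
  by apply: measurableT_comp => //; exact: measurable_rV_cons.
have fE : \int[mu n.+1]_(x in dom Torus) phi x = \int[mu n.+1]_x f x.
  by rewrite integral_mkcond epatch_indic.
rewrite fE; split.
  rewrite integral_rVS// [RHS]integral_mkcond epatch_indic; apply: eq_integral => t _.
  transitivity (\int[mu n]_y ((phi (rV_cons (t, y)) * (\1_(dom Torus) y)%:E) * (\1_I t)%:E)).
    apply: eq_integral => y _.
    by rewrite /f torus_cons EFinM -muleA [(\1_I t)%:E * _]muleC.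
  rewrite ge0_integralZr//; last 2 first.
  - apply: emeasurable_funM; first exact: (measurableT_comp mphic (measurable_pair1 t)).
    by apply/measurable_EFinP/measurable_indic; exact: measurable_torus.
  - by move=> y _; rewrite mule_ge0// lee_fin.
  by rewrite [in RHS]integral_mkcond epatch_indic.
rewrite integral_rVS// (fubini_tonelli (f \o @rV_cons R n))//; last first.
  by move=> p; exact: f0.
rewrite [RHS]integral_mkcond epatch_indic; apply: eq_integral => y _.
transitivity (\int[leb]_t ((phi (rV_cons (t, y)) * (\1_I t)%:E) * (\1_(dom Torus) y)%:E)).
  by apply: eq_integral => t _; rewrite /f /= torus_cons EFinM muleA.
rewrite ge0_integralZr//; last 2 first.
- apply: emeasurable_funM; first exact: (measurableT_comp mphic (measurable_pair2 y)).
  by apply/measurable_EFinP/measurable_indic.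
- by move=> t _; rewrite mule_ge0// lee_fin.
by rewrite [in RHS]integral_mkcond epatch_indic.
Qed.

(** Integrate first in the direction j.  For nonnegative integrands Tonelli gives
    both orders of integration unconditionally, and induction on the dimension
    moves the distinguished coordinate to the front. *)
Lemma integral_torus_line n (j : 'I_n) (phi : 'rV[R]_n -> \bar R) (c : \bar R) :
  measurable_fun [set: 'rV[R]_n] phi -> (forall x, 0 <= phi x) ->
  (forall x : 'rV[R]_n, \int[leb]_(t in I) phi (x + t *: delta_mx ord0 j)%R = c) ->
  \int[mu n]_(x in dom Torus) phi x = c.
Proof.
elim: n j phi => [[]//|n IH] j phi mphi phi0 phic.
have [E1 E2] := integral_torusS mphi phi0.
have [i ji|j0] := unliftP ord0 j.
  rewrite E1 (eq_integral (fun=> c)); last first.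
    move=> t _; apply: (IH i).
    - apply: measurableT_comp => //.
      by apply: measurableT_comp; [exact: measurable_rV_cons|exact: measurable_pair1].
    - by move=> y; exact: phi0.
    - move=> y; rewrite -(phic (rV_cons (t, y))); apply: eq_integral => s _.
      congr (phi _); apply/rowP => k; rewrite !mxE ji.
      case: (unliftP ord0 k) => [k' ->|->].
        by rewrite !mxE !eqxx/= (inj_eq lift_inj).
      by rewrite (negbTE (neq_lift _ _)) andbF mulr0 addr0.
  by rewrite integral_cst//= ?leb_I ?mule1.
rewrite E2 (eq_integral (fun=> c)); last first.
  move=> y _; rewrite -(phic (rV_cons (0%R, y))); apply: eq_integral => s _.
  congr (phi _); apply/rowP => k; rewrite !mxE j0.
  case: (unliftP ord0 k) => [k' ->|->].
    by rewrite eq_sym (eq_sym (lift _ _)) (negbTE (neq_lift _ _)) andbF mulr0 addr0.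
  by rewrite !eqxx/= mulr1 add0r.
rewrite integral_cst//=; last exact: measurable_torus.
by rewrite [X in (_ * X)%E](mu_torus n) mule1.
Qed.

(** Adding a bound M of the derivative makes the integrand nonnegative; along each
    line in the direction j the fundamental theorem of calculus and periodicity
    leave exactly M. *)
Lemma integral_torus_partial n (j : 'I_n) (h : 'rV[R]_n -> R) :
  (forall x, differentiable h x) -> continuous (partial j h) -> periodic h ->
  Rintegral (mu n) (dom Torus) (partial j h) = 0%R.
Proof.
move=> dh cg ph; set g := partial j h.
have [M M0 gM] := periodic_bounded cg (partial_periodic j ph).
have gM0 x : (0 <= g x + M)%R by have := gM x; rewrite ler_norml -/g => /andP[]; lra.
have mg : measurable_fun [set: 'rV[R]_n] g by exact: continuous_measurable_rV.
have I1 : \int[mu n]_(x in dom Torus) (g x + M)%:E = M%:E.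
  apply: (integral_torus_line (j := j)).
  - by apply/measurable_EFinP; apply: measurable_funD.
  - by move=> x; rewrite lee_fin.
  move=> x; set e := delta_mx _ _.
  have cge : continuous (fun t : R => g (x + t *: e) + M)%R.
    move=> t; apply: cvgD; last exact: cvg_cst.
    by apply: continuous_comp; [exact: continuous_line|exact: cg].
  rewrite integral_itv_bndo_bndc; last first.
    by apply/measurable_EFinP/measurable_funTS; exact: continuous_measurable_fun.
  pose F t : R := (h (x + t *: e) + M * t)%R.
  have dF (t : R) : is_derive t (1%R : R) F (g (x + t *: e) + M)%R.
    have d1 := is_derive_line (x := x) (v := e) (dh (x + t *: e)%R).
    have d2 := is_deriveD d1 (is_deriveZ M (is_derive_id t 1%R)).
    rewrite (_ : g _ + M = 'd h (x + t *: e) e + M *: 1)%R; last first.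
      by rewrite /g /partial deriveE// /GRing.scale/= mulr1.
    exact: d2.
  have cF : continuous F.
    move=> t; apply: differentiable_continuous; apply/derivable1_diffP.
    exact: ex_derive.
  rewrite (@continuous_FTC2 _ _ F).
  - rewrite -EFinB /F; congr EFin.
    have -> : (x + 2^-1 *: e = x + (- 2^-1) *: e + of_Zd (delta_mx ord0 j))%R.
      apply/rowP => i; rewrite !mxE.
      by case: (_ && _); rewrite ?mulr1n ?mulr0n; lra.
    rewrite ph; lra.
  - lra.
  - exact: continuous_subspaceT.
  - split; first by move=> t _; exact: ex_derive.
    + by apply: cvg_at_right_filter; exact: cF.
    + by apply: cvg_at_left_filter; exact: cF.
  - by move=> t _; rewrite derive1E derive_val.
have mT : measurable (dom Torus : set 'rV[R]_n) by exact: measurable_torus.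
have muT : (mu n (dom Torus) < +oo)%E by rewrite [X in X < _](mu_torus n) ltry.
have ig : (mu n).-integrable (dom Torus) (EFin \o g).
  apply: measurable_bounded_integrable => //; first exact: measurable_funTS.
  exists M; split; first exact: num_real.
  by move=> K MK x _; apply: le_trans (gM x) (ltW MK).
have iM : (mu n).-integrable (dom Torus) (EFin \o cst M).
  apply: measurable_bounded_integrable => //.
  exists M; split; first exact: num_real.
  by move=> K MK x _ /=; rewrite ger0_norm ?(ltW MK).
have := RintegralD mT ig iM; rewrite {1}/Rintegral I1 /= Rintegral_cst//.
rewrite [X in fine X](mu_torus n)/= mulr1 => /eqP.
by rewrite eq_sym -subr_eq0 addrK => /eqP.
Qed.

End slices.

(** * Sums over the lattice *)

Section lattice_sum.
Context {R : realType} {d : nat}.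
Local Notation Zd := 'rV[int]_d.
Implicit Types (a b M : Zd -> R) (s : seq Zd).

Definition dominating M := (forall k, 0 <= M k) /\
  (\esum_(k in [set: Zd]) (M k)%:E < +oo)%E.

Lemma dominatingD M N : dominating M -> dominating N ->
  dominating (fun k => M k + N k).
Proof.
move=> [M0 Moo] [N0 Noo]; split=> [k|]; first by rewrite addr_ge0.
under eq_esum do rewrite EFinD.
by rewrite esumD ?lte_add_pinfty// => k _; rewrite lee_fin.
Qed.

Lemma esum_fin_le M s : (forall k, 0 <= M k) -> uniq s ->
  ((\sum_(k <- s) M k)%:E <= \esum_(k in [set: Zd]) (M k)%:E)%E.
Proof.
move=> M0 us; apply: esum_ge; exists [set` s]; first by split; [exact: finite_seq|exact: subsetT].
by rewrite -fsbig_seq//= sumEFin.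
Qed.

Lemma dominatingZ c M : 0 <= c -> dominating M -> dominating (fun k => c * M k).
Proof.
move=> c0 [M0 Moo]; split=> [k|]; first by rewrite mulr_ge0.
set S := (\esum_(k in _) _)%E in Moo.
have Sf : S \is a fin_num by rewrite ge0_fin_numE//; apply: esum_ge0 => k _; rewrite lee_fin.
apply: (@le_lt_trans _ _ (c * fine S)%:E); last by rewrite ltry.
apply: ub_ereal_sup => _ [A [finA _] <-].
rewrite fsbig_finite//= sumEFin lee_fin -mulr_sumr ler_wpM2l//.
rewrite -lee_fin fineK//; apply: esum_fin_le => //; exact: finmap.fset_uniq.
Qed.

(** The finite set depends on M and e only, not on the family a; this uniformity
    is what passes linearity, continuity and differentiability to the sum.  The
    index k0 can be forced into the set because enlarging it does no harm. *)
Lemma lattice_sum_approx M (k0 : Zd) (e : R) : dominating M -> 0 < e ->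
  exists s, [/\ uniq s, k0 \in s &
    forall a, (forall k, `|a k| <= M k) ->
      `|lattice_sum a - \sum_(k <- s) a k| <= e].
Proof.
move=> [M0 Moo] e0.
set S := (\esum_(k in _) _)%E in Moo.
have Sf : S \is a fin_num by rewrite ge0_fin_numE//; apply: esum_ge0 => k _; rewrite lee_fin.
have [_ [A [finA _] <-] AS] := ub_ereal_sup_adherent e0 Sf.
pose B := A `|` [set k0].
have finB : finite_set B by rewrite finite_setU; split => //.
pose s : seq Zd := finmap.enum_fset (fset_set B).
have us : uniq s by exact: finmap.fset_uniq.
(* nonnegative families below M: the tail outside B is at most e *)
have tail (b : Zd -> R) : (forall k, 0 <= b k <= M k) ->
    exists2 r : R, \esum_(k in [set: Zd]) (b k)%:E = r%:E &
      \sum_(k <- s) b k <= r <= \sum_(k <- s) b k + e.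
  move=> bM; have b0 k : 0 <= b k by have /andP[] := bM k.
  have splitB (c : Zd -> R) : (forall k, 0 <= c k) -> (\esum_(k in [set: Zd]) (c k)%:E =
      (\sum_(k <- s) c k)%:E + \esum_(k in ~` B) (c k)%:E)%E.
    move=> c0; rewrite (esumID B)//; last by move=> k _; rewrite lee_fin.
    rewrite !setTI; congr (_ + _)%E.
    rewrite esum_fset//; last by move=> k _; rewrite lee_fin.
    by rewrite fsbig_finite//= sumEFin.
  have tM : (\esum_(k in ~` B) (M k)%:E <= e%:E)%E.
    have AB : (\sum_(k \in A) (M k)%:E <= (\sum_(k <- s) M k)%:E)%E.
      rewrite -sumEFin -(fsbig_finite _ _ finB)//=.
      apply: lee_fsum_nneg_subset => //.
        by move=> k; rewrite !inE => kA; left.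
      by move=> k _; rewrite lee_fin.
    have T0 : (0 <= \esum_(k in ~` B) (M k)%:E)%E.
      by apply: esum_ge0 => k _; rewrite lee_fin.
    have Se : (S - e%:E < (\sum_(k <- s) M k)%:E)%E := lt_le_trans AS AB.
    move: Se Sf; rewrite /S (splitB M)//; move: (\esum_(k in _) _)%E T0 => [r| |]//.
    move=> _ Se _; rewrite lee_fin.
    have : \sum_(k <- s) M k + r - e < \sum_(k <- s) M k by rewrite -lte_fin; exact: Se.
    lra.
  have tb : (\esum_(k in ~` B) (b k)%:E <= e%:E)%E.
    apply: le_trans tM; apply: le_esum => k _; rewrite lee_fin.
    by have /andP[] := bM k.
  have tb0 : (0 <= \esum_(k in ~` B) (b k)%:E)%E.
    by apply: esum_ge0 => k _; rewrite lee_fin.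
  rewrite splitB//; move: (\esum_(k in ~` B) _)%E tb tb0 => [r| |]//.
  rewrite !lee_fin => re r0.
  by exists (\sum_(k <- s) b k + r); rewrite ?EFinD// lerDl r0 lerD2l.
exists s; split => //.
  by rewrite /s in_fset_set// inE; right.
move=> a aM.
have [|r1 r1E r1b] := tail (fun k => Num.max (a k) 0) _.
  by move=> k; have := aM k; rewrite ler_norml le_max lexx orbT ge_max M0 andbT => /andP[].
have [|r2 r2E r2b] := tail (fun k => Num.max (- a k) 0) _.
  move=> k; have := aM k; rewrite ler_norml le_max lexx orbT ge_max M0 andbT => /andP[? _].
  by rewrite lerNl.
rewrite /lattice_sum.
rewrite (eq_esum (b := fun k => (Num.max (a k) 0)%:E)); last first.
  by move=> k _; rewrite funeposE /= EFin_max.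
rewrite r1E (eq_esum (b := fun k => (Num.max (- a k) 0)%:E)); last first.
  by move=> k _; rewrite funenegE /= EFin_max.
rewrite r2E /=.
have -> : \sum_(k <- s) a k = \sum_(k <- s) Num.max (a k) 0 - \sum_(k <- s) Num.max (- a k) 0.
  rewrite -sumrB; apply: eq_bigr => k _.
  have [a0|a0] := leP (a k) 0; [rewrite max_l ?oppr_ge0//|rewrite max_r ?oppr_le0 ?ltW//]; lra.
rewrite ler_norml; move: r1b r2b => /andP[? ?] /andP[? ?]; apply/andP; split; lra.
Qed.

(** Lets an error of the form K e, with K independent of e, be sent to zero. *)
Lemma ler_scale_eps (x K : R) : 0 <= K -> (forall e, 0 < e -> x <= K * e) -> x <= 0.
Proof.
move=> K0 xK; apply/ler_addgt0Pr => e e0; rewrite add0r.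
have K1 : 0 < K + 1 by rewrite ltr_wpDl.
apply: le_trans (xK _ (divr_gt0 e0 K1)) _.
by rewrite mulrCA ger_pMr// ler_pdivrMr// mul1r lerDl.
Qed.

Lemma lattice_sum_lin (J : finType) (c : J -> R) (a : J -> Zd -> R) M :
  dominating M -> (forall j k, `|a j k| <= M k) ->
  lattice_sum (fun k => \sum_j c j * a j k) = \sum_j c j * lattice_sum (a j).
Proof.
move=> dM aM; apply/eqP; rewrite -subr_eq0 -normr_le0.
pose K := 1 + \sum_j `|c j|.
have c0 : 0 <= \sum_j `|c j| by rewrite sumr_ge0.
have K1 : 1 <= K by rewrite lerDl.
have K0 : 0 <= K by rewrite (le_trans _ K1).
apply: (@ler_scale_eps _ K) => // e e0.
have [s [_ _ sP]] := lattice_sum_approx 0 (dominatingZ K0 dM) e0.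
have aKM j k : `|a j k| <= K * M k.
  by rewrite (le_trans (aM j k))// ler_peMl//; case: dM.
have caKM k : `|\sum_j c j * a j k| <= K * M k.
  rewrite (le_trans (ler_norm_sum _ _ _))//.
  apply: (@le_trans _ _ (\sum_j `|c j| * M k)).
    by apply: ler_sum => j _; rewrite normrM ler_wpM2l.
  by rewrite -mulr_suml ler_wpM2r ?lerDr//; case: dM.
rewrite -(subrKA (\sum_(k <- s) \sum_j c j * a j k)) (le_trans (ler_normD _ _))//.
rewrite mulrDl mul1r lerD//; first exact: sP.
rewrite exchange_big/= -sumrB (le_trans (ler_norm_sum _ _ _))//.
rewrite mulr_suml; apply: ler_sum => j _.
by rewrite -mulr_sumr -mulrBr normrM ler_wpM2l// distrC sP.
Qed.

Lemma lattice_sumB a b M : dominating M -> (forall k, `|a k| <= M k) ->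
  (forall k, `|b k| <= M k) ->
  lattice_sum (fun k => a k - b k) = lattice_sum a - lattice_sum b.
Proof.
move=> dM aM bM.
have := @lattice_sum_lin bool (fun i => if i then 1 else -1)
  (fun i => if i then a else b) M dM.
rewrite big_bool/= mul1r mulN1r => <-; last by case.
by congr lattice_sum; apply/funext => k; rewrite big_bool/= mul1r mulN1r.
Qed.

Lemma lattice_sumZ c a M : dominating M -> (forall k, `|a k| <= M k) ->
  lattice_sum (fun k => c * a k) = c * lattice_sum a.
Proof.
move=> dM aM.
have := @lattice_sum_lin unit (fun=> c) (fun=> a) M dM (fun=> aM).
rewrite big_const card_unit/= addr0 => <-.
by congr lattice_sum; apply/funext => k; rewrite big_const card_unit/= addr0.
Qed.

Definition total M : R := fine (\esum_(k in [set: Zd]) (M k)%:E)%E.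

Lemma sum_le_total M s : dominating M -> uniq s -> \sum_(k <- s) M k <= total M.
Proof.
move=> [M0 Moo] us; rewrite -lee_fin fineK; first exact: esum_fin_le.
by rewrite ge0_fin_numE//; apply: esum_ge0 => k _; rewrite lee_fin.
Qed.

Lemma lattice_sum_le a M c : dominating M -> 0 <= c ->
  (forall k, `|a k| <= c * M k) -> `|lattice_sum a| <= c * total M.
Proof.
move=> dM c0 aM; apply/ler_addgt0Pr => e e0.
have [s [us _ sP]] := lattice_sum_approx 0 (dominatingZ c0 dM) e0.
rewrite -(subrK (\sum_(k <- s) a k) (lattice_sum a)) (le_trans (ler_normD _ _))//.
rewrite addrC lerD ?sP// (le_trans (ler_norm_sum _ _ _))//.
apply: (@le_trans _ _ (\sum_(k <- s) c * M k)); first exact: ler_sum.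
by rewrite -mulr_sumr ler_wpM2l// sum_le_total.
Qed.

(** The bound with c' on the whole family only ensures summability; the estimate
    itself involves the terms other than the one at k0. *)
Lemma lattice_sum_main_term a (k0 : Zd) M c c' : dominating M -> 0 <= c -> 0 <= c' ->
  (forall k, `|a k| <= c' * M k) -> (forall k, k != k0 -> `|a k| <= c * M k) ->
  `|lattice_sum a - a k0| <= c * total M.
Proof.
move=> dM c0 c'0 aM' aM; apply/ler_addgt0Pr => e e0.
have [s [us k0s sP]] := lattice_sum_approx k0 (dominatingZ c'0 dM) e0.
rewrite -(subrKA (\sum_(k <- s) a k)) (le_trans (ler_normD _ _))//.
rewrite addrC lerD ?sP// (bigD1_seq k0)//= addrAC subrr add0r.
rewrite (le_trans (ler_norm_sum _ _ _))//.
apply: (@le_trans _ _ (\sum_(k <- s | k != k0) c * M k)); first exact: ler_sum.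
rewrite -mulr_sumr ler_wpM2l// (le_trans _ (sum_le_total dM us))//.
by rewrite [leRHS](bigD1_seq k0)//= lerDr; case: dM.
Qed.

(** Periodicity of a periodization comes from here. *)
Lemma lattice_sum_shift a (l : Zd) :
  lattice_sum (fun k => a (k + l)) = lattice_sum a.
Proof.
have bij : set_bij [set: Zd] [set: Zd] (fun k => k + l).
  split=> //; first by move=> k1 k2 _ _ /addIr.
  by move=> k _; exists (k - l) => //; rewrite subrK.
rewrite /lattice_sum; congr (fine (_ - _)%E).
- rewrite [RHS](reindex_esum _ _ _ _ bij); apply: eq_esum => k _.
  by rewrite !funeposE.
- rewrite [RHS](reindex_esum _ _ _ _ bij); apply: eq_esum => k _.
  by rewrite !funenegE.
Qed.

Lemma lattice_sum_continuous (T : topologicalType) (a : Zd -> T -> R) (x0 : T) M :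
  dominating M -> (forall k, {for x0, continuous (a k)}) ->
  (\forall x \near x0, forall k, `|a k x| <= M k) ->
  {for x0, continuous (fun x => lattice_sum (a^~ x))}.
Proof.
move=> dM ca aM; apply/cvgrPdist_le => /= e e0.
have e3 : 0 < e / 3 by rewrite divr_gt0.
have [s [_ _ sP]] := lattice_sum_approx 0 dM e3.
have cs : {for x0, continuous (fun x => \sum_(k <- s) a k x)}.
  by apply: cvg_big => [|k _]; [exact: add_continuous|exact: ca].
have /cvgrPdist_le/(_ _ e3) cs' := cs.
have aM0 : forall k, `|a k x0| <= M k by exact: nbhs_singleton aM.
near=> x.
have aMx : forall k, `|a k x| <= M k by near: x.
have := sP _ aM0; have := sP _ aMx.
have : `|(\sum_(k <- s) a k x0) - \sum_(k <- s) a k x| <= e / 3 by near: x.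
rewrite !ler_norml => /andP[? ?] /andP[? ?] /andP[? ?]; apply/andP; split; lra.
Unshelve. all: by end_near. Qed.

End lattice_sum.

(** * Termwise differentiation *)

Section C1_sum.
Context {R : realType} {d : nat}.
Local Notation V := 'rV[R]_d.

Lemma diffE_partial (h : V -> R) (x v : V) : differentiable h x ->
  'd h x v = \sum_j v ord0 j * partial j h x.
Proof.
move=> dh; rewrite [in LHS](row_sum_delta v) linear_sum; apply: eq_bigr => j _.
by rewrite linearZ/= /partial deriveE.
Qed.

Lemma diff_scale_dir (h : V -> R) (x v : V) (c : R) :
  'd h x (c *: v) = c * 'd h x v.
Proof. by rewrite linearZ. Qed.

Lemma norm_diff_le (h : V -> R) (x v : V) B : differentiable h x ->
  (forall j, `|partial j h x| <= B) -> `|'d h x v| <= d%:R * B * `|v|.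
Proof.
move=> dh hB; rewrite diffE_partial// (le_trans (ler_norm_sum _ _ _))//.
apply: (@le_trans _ _ (\sum_(j < d) B * `|v|)); last first.
  by rewrite sumr_const card_ord mulr_natl mulrnAl.
apply: ler_sum => j _; rewrite normrM mulrC ler_pM//; exact: coord_le_norm.
Qed.

Lemma mean_value_le (h : V -> R) (x v : V) B :
  (forall y, differentiable h y) ->
  (forall y j, `|y - x| <= `|v| -> `|partial j h y| <= B) ->
  `|h (x + v) - h x| <= d%:R * B * `|v|.
Proof.
move=> dh hB; pose g (t : R) := h (x + t *: v).
have dg (t : R) : is_derive t 1 g ('d h (x + t *: v) v).
  exact: is_derive_line.
have cg : {within `[0, 1], continuous g}.
  apply: continuous_subspaceT => t; apply: differentiable_continuous.
  by apply/derivable1_diffP; have [] := dg t.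
have [c c01] := MVT_segment ler01 (fun t _ => dg t) cg.
rewrite /g scale1r scale0r addr0 subr0 mulr1 => ->.
apply: norm_diff_le => // j; apply: hB; rewrite addrAC subrr add0r normrZ.
move: c01; rewrite in_itv/= => /andP[c0 c1].
by rewrite ger0_norm// ler_piMl.
Qed.

(** The first-order estimate determines the differential, which is how the
    differential of a sum is recognised as a given linear form. *)
Lemma differentiable_criterion (h : V -> R) (x : V) (L : {linear V -> R}) :
  continuous L ->
  (forall e, 0 < e -> \forall v \near (0 : V), `|h (x + v) - h x - L v| <= e * `|v|) ->
  differentiable h x /\ 'd h x = L :> (V -> R).
Proof.
move=> cL hL.
have oh : h \o shift x = cst (h x) + L +o_ (0 : V) id.
  apply/eqaddoP => _/posnumP[e].
  have := hL e%:num ltac:(by []); apply: filterS => v /=.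
  rewrite -[X in _ -> `|X| <= _]/(h (v + x) - (h x + L v)).
  by rewrite opprD addrA (addrC v).
have dE := diff_unique cL oh; split => //.
by apply/diff_locallyP; rewrite dE.
Qed.

End C1_sum.

Section C1_sum.
Context {R : realType} {d : nat}.
Local Notation V := 'rV[R]_d.

(** The linear form with coefficients c, as a candidate differential. *)
Definition lincomb (c : 'I_d -> R) (v : V) : R := \sum_j v ord0 j * c j.

Lemma lincomb_linear c : linear (lincomb c : V -> R^o).
Proof.
move=> a u v; rewrite /lincomb /GRing.scale/= mulr_sumr -big_split/=.
by apply: eq_bigr => j _; rewrite !mxE mulrDl mulrA.
Qed.

HB.instance Definition _ c :=
  @GRing.isLinear.Build R V R^o *:%R (lincomb c) (lincomb_linear c).

Lemma lincomb_continuous c : continuous (lincomb c).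
Proof.
apply: continuous_big => [|j _ v]; first exact: add_continuous.
exact: (cvgM (@coord_continuous R 1 d ord0 j v) (cvg_cst (c j))).
Qed.

Variable a : 'rV[int]_d -> V -> R.
Hypothesis aC1 : forall k, Defs.C1 (a k).
Hypothesis a_dom : forall x0 : V, exists2 M : 'rV[int]_d -> R, dominating M &
  forall x k, `|x - x0| < 1 -> `|a k x| <= M k /\ forall j, `|partial j (a k) x| <= M k.

Let F x := lattice_sum (a^~ x).
Let dF j x := lattice_sum (fun k => partial j (a k) x).

(** The remainder r of the first-order expansion is itself a lattice sum.  Divided
    by |v| its terms are dominated uniformly in v, by the mean value inequality;
    so a finite set of indices, independent of v, carries all of it up to e/2,
    and on a finite set the remainders are small because each term is
    differentiable. *)
Lemma lattice_sum_differentiable x0 :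
  differentiable F x0 /\ 'd F x0 = lincomb (fun j => dF j x0) :> (V -> R).
Proof.
apply: differentiable_criterion; first exact: lincomb_continuous.
have [M dM aM] := a_dom x0.
pose N k := (2 * d%:R + 2) * M k.
(* 2 d bounds the increment and the differential of a term together, and the
   extra 2 bounds the difference of two values *)
have D0 : 0 <= 2 * d%:R + 2 :> R by rewrite addr_ge0 ?mulr_ge0.
have dN : dominating N by exact: dominatingZ.
have M0 k : 0 <= M k by case: dM.
have MN k : M k <= N k.
  by rewrite ler_peMl// -[leLHS]add0r lerD ?mulr_ge0// ler1n.
have dist_x0 v : `|x0 + v - x0| = `|v| by rewrite addrAC subrr add0r.
have aM0 k : `|a k x0| <= M k /\ forall j, `|partial j (a k) x0| <= M k.
  by apply: aM; rewrite subrr normr0.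
have dle v k : `|'d (a k) x0 v| <= d%:R * M k * `|v|.
  by apply: norm_diff_le; [have [] := aC1 k|have [] := aM0 k].
move=> e e0.
have e2 : 0 < e / 2 by rewrite divr_gt0.
have [s [_ _ sP]] := lattice_sum_approx 0 dN e2.
pose r (v : V) k := a k (x0 + v) - a k x0 - 'd (a k) x0 v.
have rE v : `|v| < 1 -> F (x0 + v) - F x0 - lincomb (fun j => dF j x0) v =
    lattice_sum (r v).
  move=> v1.
  have avM k : `|a k (x0 + v)| <= M k.
    by have [] := aM (x0 + v) k; rewrite ?dist_x0.
  rewrite (@lattice_sumB _ _ _ _ N)//; first last.
  - move=> k; rewrite (le_trans (dle v k))//.
    rewrite (@le_trans _ _ (d%:R * M k))// ?ler_piMr ?mulr_ge0 ?(ltW v1)//.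
    rewrite ler_wpM2r// mulr_natl mulr2n -addrA lerDl addr_ge0//.
  - move=> k; rewrite (le_trans (ler_normB _ _))//.
    rewrite (@le_trans _ _ (2 * M k))// ?ler_wpM2r ?lerDr ?mulr_ge0//.
    by rewrite mulr_natl mulr2n lerD//; have [] := aM0 k.
  rewrite (@lattice_sumB _ _ _ _ M)//; last by move=> k; have [] := aM0 k.
  congr (_ - _); rewrite /lincomb.
  rewrite -(@lattice_sum_lin _ _ _ (fun j => v ord0 j)
    (fun j k => partial j (a k) x0) M)//; last first.
    by move=> j k; have [_] := aM0 k.
  congr lattice_sum; apply/funext => k.
  by rewrite diffE_partial//; have [] := aC1 k.
have r_le v k : `|v| < 1 -> `|r v k| <= `|v| * N k.
  move=> v1; rewrite (le_trans (ler_normB _ _))//.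
  have mv : `|a k (x0 + v) - a k x0| <= d%:R * M k * `|v|.
    apply: mean_value_le; first by have [] := aC1 k.
    by move=> y j yv; have [] := aM y k (le_lt_trans yv v1).
  rewrite (le_trans (lerD mv (dle v k)))// /N.
  have -> : `|v| * ((2 * d%:R + 2) * M k) =
    d%:R * M k * `|v| + d%:R * M k * `|v| + 2 * M k * `|v| by ring.
  by rewrite lerDl !mulr_ge0.
have r_small : \forall v \near (0 : V), forall k, k \in s ->
    `|r v k| <= (e / (2 * (size s).+1%:R)) * `|v|.
  have e'0 : 0 < e / (2 * (size s).+1%:R) by rewrite divr_gt0 ?mulr_gt0.
  move: (e / _) e'0 => e' e'0.
  elim: s {sP} => [|k s IH]; first by near=> v => k; rewrite in_nil.
  have rk : \forall v \near (0 : V), `|r v k| <= e' * `|v|.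
    have [dak _] := aC1 k.
    have /eqaddoP/(_ e' e'0) := diff_locally (dak x0).
    apply: filterS => v /=.
    rewrite -[X in `|X| <= _ -> _]/(a k (v + x0) - (a k x0 + 'd (a k) x0 v)).
    by rewrite opprD addrA (addrC v).
  near=> v => l; rewrite inE => /predU1P[->|].
    by near: v.
  by move: l; near: v.
have near1 : \forall v \near (0 : V), `|v| < 1.
  apply/nbhs_ballP; exists 1 => //= v.
  by rewrite -ball_normE /ball_ /= sub0r normrN.
near=> v.
have v1 : `|v| < 1 by near: v.
rewrite rE//.
have rN' k : `|r v k| <= `|v| * N k by exact: r_le.
have [v0|v0] := eqVneq v 0.
  have := lattice_sum_le dN (normr_ge0 v) rN'.
  by move=> /le_trans; apply; rewrite v0 normr0 mul0r mulr0.
have vp : 0 < `|v| by rewrite normr_gt0.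
have -> : lattice_sum (r v) = `|v| * lattice_sum (fun k => `|v|^-1 * r v k).
  rewrite (@lattice_sumZ _ _ _ _ (fun k => `|v| * N k))//.
    by rewrite mulrA divff ?mul1r// gt_eqF.
  by apply: dominatingZ => //.
rewrite normrM normr_id mulrC ler_wpM2r//.
have rN k : `| `|v|^-1 * r v k| <= N k.
  by rewrite normrM normfV normr_id ler_pdivrMl// r_le.
rewrite -(subrK (\sum_(k <- s) `|v|^-1 * r v k) (lattice_sum _)).
rewrite (le_trans (ler_normD _ _))// [leRHS]splitr lerD//; first exact: sP.
rewrite (le_trans (ler_norm_sum _ _ _))//.
apply: (@le_trans _ _ (\sum_(k <- s) (e / (2 * (size s).+1%:R)))).
  rewrite big_seq [leRHS]big_seq; apply: ler_sum => k ks.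
  rewrite normrM normfV normr_id ler_pdivrMl// mulrC.
  by move: k ks; near: v.
rewrite big_const_seq count_predT iter_addr_0 -[_ *+ size s]mulr_natr.
have -> : e / (2 * (size s).+1%:R) * (size s)%:R =
    e / 2 * ((size s)%:R / (size s).+1%:R).
  by rewrite invfM mulrA mulrAC -!mulrA.
by rewrite ler_piMr ?(ltW e2)// ler_pdivrMr// mul1r ler_nat.
Unshelve. all: by end_near. Qed.

Lemma partial_lattice_sum j x : partial j F x = dF j x.
Proof.
have [dFx dE] := lattice_sum_differentiable x.
rewrite /partial deriveE// dE /lincomb (bigD1 j)//= mxE !eqxx mul1r big1 ?addr0//.
by move=> i ij; rewrite mxE (negbTE ij) andbF mul0r.
Qed.

Lemma lattice_sum_C1 : Defs.C1 F.
Proof.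
split=> [x|j x0]; first by have [] := lattice_sum_differentiable x.
rewrite (_ : partial j F = dF j); last exact/funext/partial_lattice_sum.
have [M dM aM] := a_dom x0.
apply: (lattice_sum_continuous dM (a := fun k => partial j (a k))).
  by move=> k; have [_] := aC1 k; exact.
apply/nbhs_ballP; exists 1 => //= x.
rewrite -ball_normE /ball_ /= distrC => x1 k.
by have [_] := aM x k x1.
Qed.

End C1_sum.

(** * Decaying functions and their translates *)

Section decay.
Context {R : realType} {d : nat}.
Hypothesis d0 : (0 < d)%N.
Local Notation V := 'rV[R]_d.
Implicit Types (phi : V -> R) (x y : V) (s lam C : R) (k : 'rV[int]_d).

Lemma norm_le_enorm x : `|x| <= enorm x.
Proof.
apply: norm_rV_le => [|i]; first exact: sqrtr_ge0.
rewrite /enorm /dot -sqrtr_sqr ler_wsqrtr//.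
rewrite (bigD1 i)//= -expr2 lerDl sumr_ge0// => j _.
by rewrite -expr2 sqr_ge0.
Qed.

Lemma norm_of_Zd_ge1 k : k != 0 -> 1 <= `|of_Zd k : V|.
Proof.
move=> k0; have [i ki] : exists i, k ord0 i != 0.
  apply/existsP; apply: contraNT k0 => /existsPn k0.
  by apply/eqP/rowP => i; rewrite mxE; apply/eqP; rewrite -[_ == _]negbK k0.
apply: le_trans (coord_le_norm _ i); rewrite mxE -intr_norm ler1z.
by rewrite -gtz0_ge1 normr_gt0.
Qed.

Lemma psi_antitone s x (r : R) : 0 <= s -> 0 < r -> r <= 1 + `|x| ->
  psi s x <= r `^ (- s).
Proof.
move=> s0 r0 rx; rewrite /psi !powRN lef_pV2 ?posrE ?powR_gt0//.
by rewrite ge0_ler_powR// nnegrE ?addr_ge0// ltW.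
Qed.

(** Peetre's inequality: 1 + |x| <= (1 + |x + y|)(1 + |y|). *)
Lemma psi_translate s x y : 0 <= s -> psi s (x + y) <= (1 + `|y|) `^ s * psi s x.
Proof.
move=> s0; have y0 : 0 < 1 + `|y| by rewrite ltr_pwDl.
have -> : (1 + `|y|) `^ s = (1 + `|y|)^-1 `^ (- s).
  by rewrite -powR_inv1 ?(ltW y0)// -powRrM mulrNN mul1r.
apply: psi_le_scale; rewrite ?invr_gt0//.
rewrite mulrC ler_pdivrMr// mulrDl mul1r mulrDr mulr1.
have : `|x| <= `|x + y| + `|y| by rewrite -{1}(addrK y x) ler_normB.
have : 0 <= `|x + y| * `|y| by rewrite mulr_ge0.
lra.
Qed.

(** A nonzero lattice vector has norm at least 1, so on the cell of radius lam/2
    the displacement y cannot undo more than half of lam k. *)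
Lemma norm_cell lam y k : 0 <= lam -> `|y| <= lam / 2 -> k != 0 ->
  lam / 2 * `|of_Zd k : V| <= `|y + lam *: of_Zd k|.
Proof.
move=> lam0 ylam k0; have k1 := norm_of_Zd_ge1 k0.
have : `|lam *: (of_Zd k : V)| <= `|y + lam *: of_Zd k| + `|y|.
  by rewrite -{1}(addrK y (lam *: _)) (addrC _ y) ler_normB.
rewrite normrZ ger0_norm// => h.
have : lam / 2 <= lam / 2 * `|of_Zd k : V| by rewrite ler_peMr// divr_ge0.
move: h ylam; set N := `|of_Zd k : V|; set M := `|_ + _|; set Y := `|y|.
by rewrite mulrAC; lra.
Qed.

(** The uniform bound behind every use of dominated convergence: the decay in y
    and the summability in k separate.  The constant 6 comes from
    (1 + |y|)(1 + |k|) <= (3 lam / 2)(2 |k|) = 3 lam |k| <= 6 |y + lam k|. *)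
Lemma psi_cell s lam y k : 0 <= s -> 1 <= lam -> `|y| <= lam / 2 ->
  psi s (y + lam *: of_Zd k) <= 6 `^ s * psi s y * psi s (of_Zd k : V).
Proof.
move=> s0 lam1 ylam; have lam0 : 0 <= lam by rewrite (le_trans _ lam1).
have y1 : 0 < 1 + `|y| by rewrite ltr_pwDl.
have k1 : 0 < 1 + `|of_Zd k : V| by rewrite ltr_pwDl.
have -> : 6 `^ s * psi s y * psi s (of_Zd k : V) =
    ((1 + `|y|) * (1 + `|of_Zd k : V|) / 6) `^ (- s).
  rewrite 2?powRM ?mulr_ge0 ?ltW// [RHS]mulrC mulrA; congr (_ * _ * _).
  by rewrite -powR_inv1// -powRrM mulrNN mul1r.
apply: psi_antitone => //.
have [->|kn0] := eqVneq k 0.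
  rewrite (_ : of_Zd 0 = 0) ?scaler0 ?normr0 ?addr0 ?mulr1; last first.
    by apply/rowP => i; rewrite !mxE.
  by rewrite ler_pdivrMr// ler_peMr ?ler1n// ltW.
have := norm_cell lam0 ylam kn0; have := norm_of_Zd_ge1 kn0.
rewrite ler_pdivrMr//; set N := `|of_Zd k : V|; set M := `|_ + _|; set Y := `|y| in ylam *.
move=> N1 MN.
have : (1 + Y) * (1 + N) <= (lam + lam / 2) * (N + N).
  by rewrite ler_pM ?addr_ge0 ?normr_ge0// lerD.
by lra.
Qed.

Lemma psi_cell_far s lam y k : 0 <= s -> 1 <= lam -> `|y| <= lam / 2 -> k != 0 ->
  psi s (y + lam *: of_Zd k) <= (lam / 4) `^ (- s) * psi s (of_Zd k : V).
Proof.
move=> s0 lam1 ylam k0; have lam0 : 0 < lam by rewrite (lt_le_trans _ lam1).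
apply: psi_le_scale; rewrite ?divr_gt0//.
have := norm_cell (ltW lam0) ylam k0; have := norm_of_Zd_ge1 k0.
set N := `|of_Zd k : V|; set M := `|_ + _| => N1 MN.
have : lam / 4 * (1 + N) <= lam / 4 * (N + N) by rewrite ler_wpM2l ?divr_ge0 ?(ltW lam0)// lerD.
lra.
Qed.

(** Decay at infinity is completed near the origin, where the assumed
    bound blows up, by boundedness on the unit ball. *)
Lemma decay_psi phi c s : 0 < s -> 0 <= c -> continuous phi ->
  (forall x, x != 0 -> `|phi x| <= c / enorm x `^ s) ->
  exists2 C, 0 <= C & forall x, `|phi x| <= C * psi s x.
Proof.
move=> s0 c0 cphi phic.
have [B B0 phiB] := continuous_bounded_ball 1 cphi.
have p2 : 0 < 2 `^ s :> R by rewrite powR_gt0.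
exists (2 `^ s * (B + c)) => [|x]; first by rewrite mulr_ge0 ?addr_ge0 ?(ltW p2).
have [x1|x1] := leP `|x| 1.
  apply: le_trans (phiB _ x1) _; apply: (@le_trans _ _ (B + c)); first by rewrite lerDl.
  rewrite mulrAC ler_peMl ?addr_ge0// /psi powRN -ler_pdivrMr ?invr_gt0 ?powR_gt0 ?ltr_pwDl//.
  rewrite invrK mul1r ge0_ler_powR ?nnegrE ?addr_ge0 ?(ltW s0)//.
  by rewrite -[leRHS]/(1 + 1 : R) lerD2l.
have x0 : x != 0 by rewrite -normr_gt0 (lt_trans _ x1).
have xp : 0 < `|x| by rewrite normr_gt0.
apply: le_trans (phic _ x0) _.
apply: (@le_trans _ _ (c * `|x| `^ (- s))).
  rewrite powRN ler_wpM2l// lef_pV2 ?posrE ?powR_gt0//.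
    by rewrite ge0_ler_powR ?nnegrE ?sqrtr_ge0 ?(ltW s0)// norm_le_enorm.
  exact: lt_le_trans xp (norm_le_enorm _).
apply: (@le_trans _ _ (c * (2 `^ s * psi s x))); last first.
  by rewrite mulrCA -mulrA ler_wpM2l ?(ltW p2)// ler_wpM2r ?psi_ge0// lerDr.
rewrite ler_wpM2l// /psi !powRN -ler_pdivrMl// -invfM lef_pV2 ?posrE ?mulr_gt0 ?powR_gt0 ?ltr_pwDl//.
rewrite -powRM// ge0_ler_powR ?nnegrE ?addr_ge0 ?mulr_ge0 ?(ltW s0)//.
by move: (`|x|) x1 => X; lra.
Qed.

End decay.

(** The periodization in the variable y = lam x and without the factor lam^(d/2):
    the form in which it converges. *)
Definition translates {R : realType} {d : nat} (phi : 'rV[R]_d -> R) (lam : R)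
    (y : 'rV[R]_d) : R :=
  lattice_sum (fun k => phi (y + lam *: of_Zd k)).

Lemma continuous_addr_cst {R : realType} {d : nat} (v : 'rV[R]_d) :
  continuous (fun x : 'rV[R]_d => x + v).
Proof.
move=> x; have : is_diff x (id + cst v) (id + 0).
  exact: is_diffD (is_diff_id x) (is_diff_cst v x).
by move=> dx; apply: (differentiable_continuous (f := id + cst v)).
Qed.

Section translates.
Context {R : realType} {d : nat}.
Hypothesis d0 : (0 < d)%N.
Local Notation V := 'rV[R]_d.
Implicit Types (x y : V) (lam : R) (k : 'rV[int]_d).

Lemma dominating_psi s : d%:R < s ->
  dominating (fun k => psi s (of_Zd k : V)).
Proof. by move=> ds; split=> [k|]; [exact: psi_ge0|exact: esum_psi]. Qed.

Variables (phi : V -> R) (s C : R).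
Hypotheses (ds : d%:R < s) (C0 : 0 <= C).
Hypotheses (cphi : continuous phi) (phiC : forall x, `|phi x| <= C * psi s x).

Let s0 : 0 <= s. Proof. by rewrite (le_trans _ (ltW ds)). Qed.

Lemma translates_dominated lam (r : R) y k : 1 <= lam -> `|y| <= r ->
  `|phi (y + lam *: of_Zd k)| <= C * (1 + r) `^ s * psi s (of_Zd k : V).
Proof.
move=> lam1 yr; apply: le_trans (phiC _) _.
rewrite -mulrA ler_wpM2l// addrC (le_trans (psi_translate _ _ s0))//.
rewrite ler_pM ?powR_ge0 ?psi_ge0//.
  by rewrite ge0_ler_powR ?nnegrE ?addr_ge0 ?lerD2l// (le_trans _ yr).
rewrite [leRHS]/psi psi_antitone//.
by rewrite lerD2l normrZ ler_peMl// (le_trans lam1)// ler_norm.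
Qed.

Lemma translates_continuous lam : 1 <= lam -> continuous (translates phi lam).
Proof.
move=> lam1 x0.
pose K := C * (1 + (`|x0| + 1)) `^ s.
have K0 : 0 <= K by rewrite mulr_ge0 ?powR_ge0.
apply: (lattice_sum_continuous (dominatingZ K0 (dominating_psi ds))
  (a := fun k x => phi (x + lam *: of_Zd k))).
  move=> k; apply: (@continuous_comp _ _ _ (fun x : V => x + lam *: of_Zd k) phi).
    exact: continuous_addr_cst.
  exact: cphi.
apply/nbhs_ballP; exists 1 => //= x.
rewrite -ball_normE /ball_ /= distrC => x1 k.
apply: translates_dominated => //.
by rewrite -{1}(subrK x0 x) addrC (le_trans (ler_normD _ _))// lerD2l ltW.
Qed.

Let Z := total (fun k => psi s (of_Zd k : V)).

Lemma translates_bound lam y : 1 <= lam -> `|y| <= lam / 2 ->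
  `|translates phi lam y| <= C * 6 `^ s * Z * psi s y.
Proof.
move=> lam1 ylam.
have -> : C * 6 `^ s * Z * psi s y = C * (6 `^ s * psi s y) * Z by ring.
apply: lattice_sum_le; first exact: dominating_psi.
  by rewrite !mulr_ge0 ?powR_ge0 ?psi_ge0.
move=> k; apply: le_trans (phiC _) _.
by rewrite -mulrA ler_wpM2l// psi_cell.
Qed.

(** Only the term at k = 0 survives in the limit of large lam. *)
Lemma translates_far lam y : 1 <= lam -> `|y| <= lam / 2 ->
  `|translates phi lam y - phi y| <= C * (lam / 4) `^ (- s) * Z.
Proof.
move=> lam1 ylam.
rewrite -{2}(addr0 y) -(_ : lam *: of_Zd 0 = 0); last first.
  by apply/rowP => i; rewrite !mxE mulr0.
apply: (lattice_sum_main_term (k0 := 0) (c' := C * (6 `^ s * psi s y))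
  (a := fun k => phi (y + lam *: of_Zd k))).
- exact: dominating_psi.
- by rewrite mulr_ge0 ?powR_ge0.
- by rewrite !mulr_ge0 ?powR_ge0 ?psi_ge0.
- move=> k; apply: le_trans (phiC _) _.
  by rewrite -mulrA ler_wpM2l// psi_cell.
- move=> k k0; apply: le_trans (phiC _) _.
  by rewrite -mulrA ler_wpM2l// psi_cell_far.
Qed.

Lemma translates_cvg y : translates phi lam y @[lam --> +oo] --> phi y.
Proof.
have sp : 0 < s by rewrite (le_lt_trans _ ds).
have bd : C * (lam / 4) `^ (- s) * Z @[lam --> +oo] --> (0 : R).
  have c4 : (lam / 4 : R) @[lam --> +oo] --> +oo.
    apply/cvgryPge => A; near=> t.
    have : A * 4 <= t by near: t; apply: nbhs_pinfty_ge; rewrite num_real.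
    by rewrite ler_pdivlMr.
  suff : C * (lam / 4) `^ (- s) * Z @[lam --> +oo] --> C * 0 * Z.
    by rewrite mulr0 mul0r.
  apply: cvgM; last exact: cvg_cst.
  apply: cvgM; first exact: cvg_cst.
  exact: (cvg_comp _ _ c4 (cvg_powRN_pinfty sp)).
apply/cvgrPdist_le => /= e e0.
have /cvgr0Pnorm_le/(_ _ e0) := bd.
apply: filter_app; near=> lam => /(le_trans (ler_norm _)) he.
rewrite distrC (le_trans (translates_far _ _))//.
  have : `|y| * 2 <= lam by near: lam; apply: nbhs_pinfty_ge; rewrite num_real.
  by rewrite ler_pdivlMr.
Unshelve. all: by end_near. Qed.

End translates.

Section scaled_sum.
Context {R : realType} {d : nat}.
Hypothesis d0 : (0 < d)%N.
Local Notation V := 'rV[R]_d.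
Variables (phi : V -> R) (s s' C C' : R).
Hypotheses (ds : d%:R < s) (C0 : 0 <= C) (ds' : d%:R < s') (C'0 : 0 <= C').
Hypothesis phiC1 : Defs.C1 phi.
Hypotheses (phiC : forall x, `|phi x| <= C * psi s x).
Hypotheses (dphiC : forall j x, `|partial j phi x| <= C' * psi s' x).

(** The difference quotient of the scaled function in a direction e is that of phi
    in the direction lam e. *)
Lemma differentiable_scale (lam : R) (v x : V) :
  differentiable (fun x => phi (lam *: (x + v))) x /\
  forall j, partial j (fun x => phi (lam *: (x + v))) x =
    lam * partial j phi (lam *: (x + v)).
Proof.
pose l (x : V) : V := lam *: (x + v).
have dl : is_diff x l (fun h => lam *: h).
  have d1 : is_diff x (fun x : V => x + v) id.
    have := is_diffD (is_diff_id x) (is_diff_cst v x).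
    by rewrite addr0.
  exact: (is_diff_comp d1 (is_diff_scaler lam (x + v))).
have dphi : is_diff (l x) phi ('d phi (l x)).
  by apply: differentiableP; have [] := phiC1.
have dc := is_diff_comp dl dphi.
split; first exact: (@ex_diff _ _ _ _ _ (phi \o l) _ dc).
move=> j; set e : V := delta_mx ord0 j.
have -> : partial j (fun x => phi (lam *: (x + v))) x = 'D_(lam *: e) phi (l x).
  rewrite /partial /derive.
  have -> // : (fun t : R => t^-1 *: (((fun x => phi (lam *: (x + v))) \o shift x) (t *: e) -
      phi (lam *: (x + v)))) =
    (fun t : R => t^-1 *: ((phi \o shift (l x)) (t *: (lam *: e)) - phi (l x))).
  apply/funext => t /=; rewrite scalerA (mulrC t) -scalerA.
  by rewrite -!scalerDr addrA.
have dphi' : differentiable phi (l x) by have [] := phiC1.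
by rewrite deriveE// diff_scale_dir -deriveE.
Qed.

Definition scaled_sum (lam : R) (x : V) :=
  lattice_sum (fun k => phi (lam *: (x + of_Zd k))).

Lemma scaled_sumE lam x : scaled_sum lam x = translates phi lam (lam *: x).
Proof. by congr lattice_sum; apply/funext => k; rewrite scalerDr. Qed.

Lemma scaled_sum_C1 lam : 1 <= lam -> Defs.C1 (scaled_sum lam) /\
  forall j x, partial j (scaled_sum lam) x =
    lam * translates (partial j phi) lam (lam *: x).
Proof.
move=> lam1; have lam0 : 0 < lam by rewrite (lt_le_trans _ lam1).
pose a (k : 'rV[int]_d) (x : V) := phi (lam *: (x + of_Zd k)).
have cphi : continuous phi.
  by move=> x; apply: differentiable_continuous; have [] := phiC1.
have aC1 k : Defs.C1 (a k).
  split=> [x|j]; first by have [] := differentiable_scale lam (of_Zd k) x.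
  have -> : partial j (a k) = (fun x => lam * partial j phi (lam *: (x + of_Zd k))).
    by apply/funext => x; have [_] := differentiable_scale lam (of_Zd k) x.
  have cg : continuous (fun x : V => partial j phi (lam *: (x + of_Zd k))).
    move=> x.
    apply: (@continuous_comp _ _ _ (fun x : V => lam *: (x + of_Zd k)) (partial j phi)).
      apply: (@continuous_comp _ _ _ (fun x : V => x + of_Zd k) (fun x : V => lam *: x)).
        exact: continuous_addr_cst.
      exact: scaler_continuous.
    by have [_] := phiC1; exact.
  by move=> x; exact: (cvgM (cvg_cst lam) (cg x)).
have a_dom (x0 : V) : exists2 M : 'rV[int]_d -> R, dominating M &
  forall x k, `|x - x0| < 1 -> `|a k x| <= M k /\ forall j, `|partial j (a k) x| <= M k.
  pose K := C * (1 + lam * (`|x0| + 1)) `^ s.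
  pose K' := lam * (C' * (1 + lam * (`|x0| + 1)) `^ s').
  have K0 : 0 <= K by rewrite mulr_ge0 ?powR_ge0.
  have K'0 : 0 <= K' by rewrite !mulr_ge0 ?powR_ge0 ?(ltW lam0).
  have dM1 := dominatingZ K0 (dominating_psi d0 ds).
  have dM2 := dominatingZ K'0 (dominating_psi d0 ds').
  exists (fun k => K * psi s (of_Zd k : V) + K' * psi s' (of_Zd k : V)).
    exact: dominatingD.
  move=> x k xx0.
  have lx : `|lam *: x| <= lam * (`|x0| + 1).
    rewrite normrZ gtr0_norm// ler_wpM2l ?(ltW lam0)//.
    by rewrite -{1}(subrK x0 x) addrC (le_trans (ler_normD _ _))// lerD2l ltW.
  split=> [|j].
    rewrite (@le_trans _ _ (K * psi s (of_Zd k : V)))//; last first.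
      by rewrite lerDl; case: dM2.
    by rewrite /a scalerDr translates_dominated.
  have [_ ->] := differentiable_scale lam (of_Zd k) x.
  rewrite (@le_trans _ _ (K' * psi s' (of_Zd k : V)))//; last first.
    by rewrite lerDr; case: dM1.
  rewrite normrM gtr0_norm// -mulrA ler_wpM2l ?(ltW lam0)// scalerDr.
  by apply: translates_dominated.
split; first exact: (lattice_sum_C1 aC1 a_dom).
move=> j x; rewrite (partial_lattice_sum aC1 a_dom) /translates.
have K'0 : 0 <= C' * (1 + `|lam *: x|) `^ s' by rewrite mulr_ge0 ?powR_ge0.
rewrite -(lattice_sumZ _ (dominatingZ K'0 (dominating_psi d0 ds'))); last first.
  by move=> k; apply: translates_dominated.
congr lattice_sum; apply/funext => k.
by have [_ ->] := differentiable_scale lam (of_Zd k) x; rewrite scalerDr.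
Qed.

End scaled_sum.

(** * Dominated convergence on growing cubes *)

Section dcvg.
Context {R : realType} {d : nat}.
Hypothesis d0 : (0 < d)%N.
Local Notation V := 'rV[R]_d.
Local Notation mu := (@lebesgue_rV R d).

Lemma torus_norm (x : V) : dom Torus x -> `|x| <= 2^-1.
Proof.
move=> xT; apply: norm_rV_le => // i; have /andP[x1 x2] := xT i.
by rewrite ler_norml x1 ltW.
Qed.

Lemma torus_ball (x : V) : `|x| < 2^-1 -> dom Torus x.
Proof.
move=> x1 i; have := le_lt_trans (coord_le_norm x i) x1.
by rewrite ltr_norml => /andP[a b]; rewrite (ltW a) b.
Qed.

(** After the substitution y = lam x the integrals run over growing cubes; with
    the indicator of the cube in the integrand they become integrals over the
    whole space, dominated by a fixed integrable weight. *)
Lemma cvg_torus_integral (K : R -> V -> R) (L : V -> R) (s C : R) :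
  d%:R < s ->
  (forall lam, 1 <= lam -> measurable_fun [set: V] (K lam)) ->
  measurable_fun [set: V] L ->
  (forall lam y, 1 <= lam -> `|y| <= lam / 2 -> `|K lam y| <= C * psi s y) ->
  (forall y, K lam y @[lam --> +oo] --> L y) ->
  Rintegral mu (dom Torus) (fun x => lam ^+ d * K lam (lam *: x)) @[lam --> +oo]
    --> Rintegral mu setT L.
Proof.
move=> ds mK mL KC KL.
apply/cvg_pinftyP => u uoo.
(* nothing is assumed for small parameters, where the integrand is replaced by 0 *)
pose K' n (y : V) : R := if 1 <= u n then (\1_(dom Torus) ((u n)^-1 *: y)) * K (u n) y else 0.
have mK' n : measurable_fun [set: V] (EFin \o K' n).
  apply/measurable_EFinP; rewrite /K'; have [un|_] := boolP (1 <= u n); last exact: measurable_cst.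
  apply: measurable_funM; last exact: mK.
  exact: (measurableT_comp (measurable_indic measurable_torus) (measurable_scale (u n)^-1)).
have ipsi : mu.-integrable setT (EFin \o (fun y : V => C * psi s y)).
  rewrite (_ : EFin \o _ = (fun y : V => C%:E * (psi s y)%:E)%E)//.
  by apply: integrableZl => //; exact: integrable_psi.
have uge A : \forall n \near \oo, A <= u n.
  by move: A; apply/cvgryPge.
have in_torus lam (y : V) : 1 <= lam -> dom Torus (lam^-1 *: y) -> `|y| <= lam / 2.
  move=> lam1 /torus_norm; have lam0 : 0 < lam by rewrite (lt_le_trans _ lam1).
  by rewrite normrZ gtr0_norm ?invr_gt0// ler_pdivrMl.
have K'C : {ae mu, forall (y : V) n, setT y -> (`|(EFin \o K' n) y| <= (C * psi s y)%:E)%E}.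
  apply: aeW => /= y n _; rewrite lee_fin /K'.
  have Cp : 0 <= C * psi s y.
    apply: (le_trans (normr_ge0 (K (2 * `|y| + 1) y))); apply: KC.
      by rewrite lerDr mulr_ge0.
    by rewrite ler_pdivlMr// mulrC lerDl.
  case: ifPn => [un|_]; last by rewrite normr0.
  rewrite indicE; have [yT|yT] := boolP (_ \in _); last by rewrite mul0r normr0.
  by rewrite mul1r; apply: KC => //; apply: in_torus => //; move: yT; rewrite inE.
have K'L : {ae mu, forall y : V, setT y -> (EFin \o K' n) y @[n --> \oo] --> (L y)%:E}.
  apply: aeW => /= y _; apply: cvg_EFin; first exact: nearW.
  have KuL : K (u n) y @[n --> \oo] --> L y by apply: (cvg_comp _ _ uoo (KL y)).
  apply: cvg_trans KuL; apply: near_eq_cvg; near=> n.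
  have un : 1 <= u n by near: n; exact: uge.
  have yn : 2 * `|y| + 1 <= u n by near: n; exact: uge.
  have u0 : 0 < u n by rewrite (lt_le_trans _ un).
  rewrite /= /K' un indicE mem_set ?mul1r//.
  apply: torus_ball; rewrite normrZ gtr0_norm ?invr_gt0// ltr_pdivrMl//.
  by rewrite ltr_pdivlMr// mulrC; lra.
have [iL _ /= cvK] := dominated_convergence measurableT mK' (proj2 (measurable_EFinP _ _) mL) K'L ipsi K'C.
have : fine (\int[mu]_x (K' n x)%:E) @[n --> \oo] --> fine (\int[mu]_x (L x)%:E).
  apply: fine_cvg; rewrite fineK; first exact: cvK.
  exact: integrable_fin_num.
apply: cvg_trans; apply: near_eq_cvg; near=> n.
have un : 1 <= u n by near: n; exact: uge.
have u0 : 0 < u n by rewrite (lt_le_trans _ un).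
rewrite /Rintegral; congr fine.
rewrite -(integral_scale u0); last exact: mK'.
rewrite [RHS]integral_mkcond; apply: eq_integral => x _.
rewrite /= patchE /K' un scalerA mulVf ?gt_eqF// scale1r indicE.
by case: ifPn => xT; rewrite ?mul1r ?mul0r ?mule0.
Unshelve. all: by end_near. Qed.

End dcvg.

(** * Trigonometric and complex estimates *)

Section trigo.
Context {R : realType}.

Lemma norm_sin_le (t : R) : `|sin t| <= `|t|.
Proof.
wlog t0 : t / 0 <= t => [H|].
  have [|/ltW t0] := leP 0 t; first exact: H.
  by rewrite -normrN -sinN -(normrN t) H// oppr_ge0.
have cs : {within `[0, t], continuous (@sin R)}.
  by apply: continuous_subspaceT; exact: continuous_sin.
have [c _] := MVT_segment t0 (fun x _ => is_derive_sin x) cs.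
rewrite sin0 !subr0 => ->; rewrite normrM ler_piMl//.
by have := cos_max c.
Qed.

Lemma cvg_div_pinfty (a : R) : a / lam @[lam --> +oo] --> (0 : R).
Proof.
apply/cvgr0Pnorm_lt => e e0; near=> lam.
have al : `|a| / e < lam by near: lam; apply: nbhs_pinfty_gt; rewrite num_real.
have l0 : 0 < lam by rewrite (le_lt_trans _ al)// divr_ge0 ?(ltW e0).
by rewrite normrM normfV (gtr0_norm l0) ltr_pdivrMr// mulrC -ltr_pdivrMr.
Unshelve. all: by end_near. Qed.

Lemma cvg_scaled_sin (a : R) : lam * sin (a / lam) @[lam --> +oo] --> a.
Proof.
have [->|a0] := eqVneq a 0.
  rewrite (_ : (fun lam => _) = cst 0); first exact: cvg_cst.
  by apply/funext => lam; rewrite mul0r sin0 mulr0.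
have ds : h^-1 *: (sin (h *: 1 + 0) - sin 0) @[h --> (0 : R)^'] --> (1 : R).
  have := @is_derive_sin R 0; rewrite cos0 => -[d dE].
  by rewrite -[X in _ --> X]dE; exact: d.
have il : a / lam @[lam --> +oo] --> (0 : R)^'.
  move=> A A0.
  have h : \forall lam \near +oo, a / lam != 0 -> A (a / lam) := cvg_div_pinfty a A0.
  change (\forall lam \near +oo, A (a / lam)); near=> lam.
  have l0 : 0 < lam by near: lam; apply: nbhs_pinfty_gt; rewrite num_real.
  have : a / lam != 0 by rewrite mulf_neq0// invr_eq0 gt_eqF.
  by near: lam.
have ds' : (a / lam)^-1 *: (sin (a / lam *: 1 + 0) - sin 0) @[lam --> +oo] --> (1 : R).
  exact: (cvg_comp _ _ il ds).
have cs : a * ((a / lam)^-1 *: (sin (a / lam *: 1 + 0) - sin 0)) @[lam --> +oo] --> a * 1.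
  exact: (cvgM (cvg_cst a) ds').
rewrite mulr1 in cs; apply: cvg_trans cs; apply: near_eq_cvg; near=> lam.
have l0 : 0 < lam by near: lam; apply: nbhs_pinfty_gt; rewrite num_real.
rewrite /= addr0 sin0 subr0 /GRing.scale/= mulr1 invf_div mulrA.
by rewrite mulrCA divff ?mulr1.
Unshelve. all: by end_near. Qed.

Lemma cvg_cos_inv (a : R) : cos (a / lam) @[lam --> +oo] --> (1 : R).
Proof.
rewrite -[X in _ --> X]cos0.
exact: (cvg_comp _ _ (cvg_div_pinfty a) (@continuous_cos R 0)).
Qed.

Lemma one_sub_cos (t : R) : 1 - cos t = 2 * sin (t / 2) ^+ 2.
Proof.
rewrite [in LHS](splitr t) -mulr2n cos_mulr2n cos2sin2 -[_ *+ 2]mulr_natl; ring.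
Qed.

End trigo.

Section complex_aux.
Context {R : realType}.

Lemma normc_sqr (z : R[i]) : normc z ^+ 2 = complex.Re z ^+ 2 + complex.Im z ^+ 2.
Proof. by case: z => a b; rewrite /= sqr_sqrtr// addr_ge0 ?sqr_ge0. Qed.

Lemma normc_ge0 (z : R[i]) : 0 <= normc z.
Proof. by case: z => a b; exact: sqrtr_ge0. Qed.

Lemma normRe_le (z : R[i]) : `|complex.Re z| <= normc z.
Proof.
by rewrite -ler_sqr ?nnegrE ?normc_ge0// normc_sqr real_normK ?num_real// lerDl sqr_ge0.
Qed.

Lemma normIm_le (z : R[i]) : `|complex.Im z| <= normc z.
Proof.
by rewrite -ler_sqr ?nnegrE ?normc_ge0// normc_sqr real_normK ?num_real// lerDr sqr_ge0.
Qed.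

End complex_aux.

(** * The Sobolev space of the torus *)

Section torus_H1.
Context {R : realType} {d : nat}.
Local Notation V := 'rV[R]_d.
Local Notation mu := (@lebesgue_rV R d).
Implicit Types (g h phi : V -> R).

Lemma integrable_torus g : continuous g -> mu.-integrable (dom Torus) (EFin \o g).
Proof.
move=> cg; apply: measurable_bounded_integrable.
- exact: measurable_torus.
- by rewrite [X in (X < _)%E](mu_torus d) ltry.
- by apply: measurable_funTS; exact: continuous_measurable_rV.
have [M _ gM] := continuous_bounded_ball 2^-1 cg.
exists M; split => [|N MN x xT]; first exact: num_real.
exact: le_trans (gM _ (torus_norm xT)) (ltW MN).
Qed.

Lemma C1_continuous g : Defs.C1 g -> continuous g.
Proof. by move=> [dg _] x; exact: differentiable_continuous. Qed.

Lemma partialM j g h x : differentiable g x -> differentiable h x ->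
  partial j (fun x => g x * h x) x = g x * partial j h x + h x * partial j g x.
Proof.
move=> dg dh; rewrite /partial -[X in 'D_(_) X x]/(g * h) deriveM//.
- exact: diff_derivable.
- exact: diff_derivable.
Qed.

Lemma integral_by_parts j g phi : Defs.C1 g -> Defs.C1 phi -> periodic g -> periodic phi ->
  Rintegral mu (dom Torus) (fun x => g x * partial j phi x) =
  - Rintegral mu (dom Torus) (fun x => partial j g x * phi x).
Proof.
move=> gC1 pC1 pg pp; apply/eqP; rewrite -addr_eq0; apply/eqP.
have cg := C1_continuous gC1; have cp := C1_continuous pC1.
have [dg cdg] := gC1; have [dp cdp] := pC1.
have c1 : continuous (fun x => g x * partial j phi x).
  by move=> x; exact: (cvgM (cg x) (cdp j x)).
have c2 : continuous (fun x => partial j g x * phi x).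
  by move=> x; exact: (cvgM (cdg j x) (cp x)).
have pE : partial j (fun x => g x * phi x) =
    (fun x => g x * partial j phi x + partial j g x * phi x).
  by apply/funext => x; rewrite partialM// (mulrC (phi x)).
rewrite -RintegralD//; [|exact: measurable_torus|exact: integrable_torus..].
rewrite -pE; apply: integral_torus_partial.
- by move=> x; exact: (differentiableM (dg x) (dp x)).
- by rewrite pE => x; exact: (cvgD (c1 x) (c2 x)).
- by move=> k x; rewrite pg pp.
Qed.

Lemma smooth_C1 phi : Defs.smooth phi -> Defs.C1 phi.
Proof.
move=> sp; split=> [x|j x]; first exact: (sp [::] x).
exact: differentiable_continuous (sp [:: j] x).
Qed.

Lemma L2_torus (F : V -> R[i]) : continuous (re F) -> continuous (im F) ->
  periodic F -> L2on Torus F.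
Proof.
move=> cr ci pF; split => //; split.
- by apply: measurable_funTS; exact: continuous_measurable_rV.
- by apply: measurable_funTS; exact: continuous_measurable_rV.
have cn : continuous (fun x => normc (F x) ^+ 2).
  rewrite (_ : (fun x => _) = (fun x => re F x * re F x + im F x * im F x)); last first.
    by apply/funext => x; rewrite normc_sqr !expr2.
  by move=> x; exact: (cvgD (cvgM (cr x) (cr x)) (cvgM (ci x) (ci x))).
have /integrableP[_] := integrable_torus cn.
by under eq_integral do rewrite /= ger0_norm ?sqr_ge0//.
Qed.

Lemma C1_H1_torus (F : V -> R[i]) : cC1 F -> periodic F -> H1 Torus F.
Proof.
move=> [rC1 iC1] pF; have pr : periodic (re F) by move=> k x; rewrite /re pF.
have pi : periodic (im F) by move=> k x; rewrite /im pF.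
have [dr cr] := rC1; have [di ci] := iC1.
split=> [|j]; first by apply: L2_torus => //; exact: C1_continuous.
exists (cpartial j F).
  apply: L2_torus => [||k x]; [exact: cr|exact: ci|].
  by rewrite /cpartial !partial_periodic.
move=> phi [/smooth_C1 sp pp].
have E1 : re (fun x => F x * (partial j phi x)%:C%C) = (fun x => re F x * partial j phi x).
  by apply/funext => x; rewrite /re; case: (F x) => a b /=; rewrite mulr0 subr0.
have E2 : im (fun x => F x * (partial j phi x)%:C%C) = (fun x => im F x * partial j phi x).
  by apply/funext => x; rewrite /im; case: (F x) => a b /=; rewrite mulr0 add0r.
have E3 : re (fun x => cpartial j F x * (phi x)%:C%C) = (fun x => partial j (re F) x * phi x).
  by apply/funext => x; rewrite /re /= mulr0 subr0.
have E4 : im (fun x => cpartial j F x * (phi x)%:C%C) = (fun x => partial j (im F) x * phi x).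
  by apply/funext => x; rewrite /im /= mulr0 add0r.
by rewrite /cintegral E1 E2 E3 E4 !integral_by_parts.
Qed.

End torus_H1.

(** * Limits of weighted integrals *)

Section good.
Context {R : realType} {d : nat}.
Hypothesis d0 : (0 < d)%N.
Local Notation V := 'rV[R]_d.
Local Notation mu := (@lebesgue_rV R d).
Implicit Types (A B : R -> V -> R) (a b : V -> R) (s t : R).

(** The hypotheses of dominated convergence on growing cubes, in a form stable
    under products, with exponents adding up.  Weights such as the coordinates
    enter with negative exponents. *)
Definition dominated_cvg s A a := [/\
  forall lam, 1 <= lam -> measurable_fun [set: V] (A lam),
  measurable_fun [set: V] a,
  exists C, forall lam y, 1 <= lam -> `|y| <= lam / 2 -> `|A lam y| <= C * psi s y &
  forall y, A lam y @[lam --> +oo] --> a y].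

Lemma psiD s t (y : V) : psi (s + t) y = psi s y * psi t y.
Proof.
rewrite /psi opprD powRD//; apply/implyP => _.
by rewrite gt_eqF// ltr_pwDl.
Qed.

Lemma dominated_cvgM s t A B a b : dominated_cvg s A a -> dominated_cvg t B b ->
  dominated_cvg (s + t) (fun lam y => A lam y * B lam y) (fun y => a y * b y).
Proof.
move=> [mA ma [CA bA] cA] [mB mb [CB bB] cB]; split.
- by move=> lam lam1; apply: measurable_funM; [exact: mA|exact: mB].
- exact: measurable_funM.
- exists (CA * CB) => lam y lam1 ylam.
  by rewrite psiD mulrACA normrM ler_pM// ?bA ?bB.
- by move=> y; exact: (cvgM (cA y) (cB y)).
Qed.

Lemma dominated_cvgD s A B a b : dominated_cvg s A a -> dominated_cvg s B b ->
  dominated_cvg s (fun lam y => A lam y + B lam y) (fun y => a y + b y).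
Proof.
move=> [mA ma [CA bA] cA] [mB mb [CB bB] cB]; split.
- by move=> lam lam1; apply: measurable_funD; [exact: mA|exact: mB].
- exact: measurable_funD.
- exists (CA + CB) => lam y lam1 ylam.
  by rewrite mulrDl (le_trans (ler_normD _ _))// lerD ?bA ?bB.
- by move=> y; exact: (cvgD (cA y) (cB y)).
Qed.

Lemma dominated_cvgZ s A a (c : R) : dominated_cvg s A a ->
  dominated_cvg s (fun lam y => c * A lam y) (fun y => c * a y).
Proof.
move=> [mA ma [CA bA] cA]; split.
- by move=> lam lam1; apply: measurable_funM => //; exact: mA.
- exact: measurable_funM.
- exists (`|c| * CA) => lam y lam1 ylam.
  by rewrite normrM -mulrA ler_wpM2l// bA.
- by move=> y; exact: (cvgM (cvg_cst c) (cA y)).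
Qed.

Lemma dominated_cvg_translates phi s C : d%:R < s -> 0 <= C -> continuous phi ->
  (forall x, `|phi x| <= C * psi s x) ->
  dominated_cvg s (translates phi) phi.
Proof.
move=> ds C0 cphi phiC; split.
- move=> lam lam1; apply: continuous_measurable_rV.
  exact: (translates_continuous d0 ds C0 cphi phiC).
- exact: continuous_measurable_rV.
- exists (C * 6 `^ s * total (fun k => psi s (of_Zd k : V))) => lam y lam1 ylam.
  exact: translates_bound.
- by move=> y; exact: (translates_cvg d0 ds C0 phiC).
Qed.

Let psiN0 (y : V) : psi 0 y = 1. Proof. by rewrite /psi oppr0 powRr0. Qed.

Let psiN1 (y : V) : psi (- 1) y = 1 + `|y|.
Proof. by rewrite /psi opprK powRr1// addr_ge0. Qed.

Lemma measurable_scaled_coord (h : R -> R) (c lam : R) j : measurable_fun setT h ->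
  measurable_fun [set: V] (fun y : V => h (c * y ord0 j / lam)).
Proof.
move=> mh; apply: (measurableT_comp mh).
by apply: measurable_funM => //; apply: measurable_funM => //; exact: measurable_coord.
Qed.

Lemma dominated_cvg_cos (c : R) j :
  dominated_cvg 0 (fun lam y => cos (c * y ord0 j / lam)) (fun=> 1).
Proof.
split.
- move=> lam _; apply: measurable_scaled_coord.
  by apply: continuous_measurable_fun; exact: continuous_cos.
- exact: measurable_cst.
- by exists 1 => lam y _ _; rewrite psiN0 mulr1 cos_max.
- by move=> y; exact: cvg_cos_inv.
Qed.

(** |sin t| <= |t| makes the bound independent of lam, at the price of one power
    of |y|. *)
Lemma dominated_cvg_sin (c : R) j : dominated_cvg (- 1)
  (fun lam y => lam * sin (c * y ord0 j / lam)) (fun y => c * y ord0 j).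
Proof.
split.
- move=> lam _; apply: measurable_funM => //; apply: measurable_scaled_coord.
  by apply: continuous_measurable_fun; exact: continuous_sin.
- by apply: measurable_funM => //; exact: measurable_coord.
- exists `|c| => lam y lam1 _; have lam0 : 0 < lam by rewrite (lt_le_trans _ lam1).
  rewrite psiN1 normrM; apply: le_trans (ler_wpM2l (normr_ge0 _) (norm_sin_le _)) _.
  rewrite -normrM mulrC divfK ?gt_eqF// normrM ler_wpM2l//.
  by rewrite (le_trans (coord_le_norm _ _))// lerDr.
- by move=> y; exact: cvg_scaled_sin.
Qed.

(** The normalisation c is the power of lam that makes the moment converge. *)
Lemma torus_limit (c : R -> R) (g K : R -> V -> R) (L : V -> R) s :
  d%:R < s -> dominated_cvg s K L ->
  (forall lam, 1 <= lam -> continuous (g lam)) ->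
  (forall lam x, 1 <= lam -> c lam * g lam x = lam ^+ d * K lam (lam *: x)) ->
  c lam * Rintegral mu (dom Torus) (g lam) @[lam --> +oo] --> Rintegral mu setT L.
Proof.
move=> ds [mK mL [C bK] cK] cg gE.
have := cvg_torus_integral d0 ds mK mL bK cK.
apply: cvg_trans; apply: near_eq_cvg; near=> lam.
have lam1 : 1 <= lam by near: lam; apply: nbhs_pinfty_ge; rewrite num_real.
rewrite -RintegralZl; [|exact: measurable_torus|exact/integrable_torus/cg].
by apply: eq_Rintegral => x _; rewrite gE.
Unshelve. all: by end_near. Qed.

End good.

(** * Moments of the periodization *)

Section periodization.
Context {R : realType} {d : nat}.
Hypothesis d0 : (0 < d)%N.
Local Notation V := 'rV[R]_d.
Local Notation mu := (@lebesgue_rV R d).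
Variables (f : V -> R[i]) (gamma beta C : R).
Hypotheses (d_gamma : d%:R < gamma) (d_gamma2 : d%:R < gamma + gamma - 2).
Hypotheses (d_beta : d%:R < beta) (C0 : 0 <= C) (fC1 : cC1 f).
Hypotheses (f_decay : forall x, normc (f x) <= C * psi gamma x).
Hypotheses (df_decay : forall j x, normc (cpartial j f x) <= C * psi beta x).

Let u := re f.
Let v := im f.

Let uC1 : Defs.C1 u. Proof. by case: fC1. Qed.
Let vC1 : Defs.C1 v. Proof. by case: fC1. Qed.
Let cu : continuous u. Proof. exact: C1_continuous. Qed.
Let cv : continuous v. Proof. exact: C1_continuous. Qed.
Let cdu j : continuous (partial j u). Proof. by case: uC1. Qed.
Let cdv j : continuous (partial j v). Proof. by case: vC1. Qed.
Let u_decay x : `|u x| <= C * psi gamma x.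
Proof. exact: le_trans (normRe_le _) (f_decay x). Qed.
Let v_decay x : `|v x| <= C * psi gamma x.
Proof. exact: le_trans (normIm_le _) (f_decay x). Qed.
Let du_decay j x : `|partial j u x| <= C * psi beta x.
Proof. exact: le_trans (normRe_le (cpartial j f x)) (df_decay j x). Qed.
Let dv_decay j x : `|partial j v x| <= C * psi beta x.
Proof. exact: le_trans (normIm_le (cpartial j f x)) (df_decay j x). Qed.

Let P lam := periodize lam f.
Let r (lam : R) : R := Num.sqrt (lam ^+ d).

Let r2 lam : 1 <= lam -> r lam * r lam = lam ^+ d.
Proof.
by move=> lam1; rewrite -expr2 sqr_sqrtr// exprn_ge0// (le_trans _ lam1).
Qed.

Lemma re_periodize lam x : re (P lam) x = r lam * translates u lam (lam *: x).
Proof.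
rewrite /re /P /periodize /clattice_sum /= mul0r subr0; congr (_ * _).
by rewrite -scaled_sumE.
Qed.

Lemma im_periodize lam x : im (P lam) x = r lam * translates v lam (lam *: x).
Proof.
rewrite /im /P /periodize /clattice_sum /= mul0r addr0; congr (_ * _).
by rewrite -scaled_sumE.
Qed.

Let C1_scaled (phi : V -> R) (c : R) : Defs.C1 phi ->
  Defs.C1 (fun x => c * phi x) /\
  forall j x, partial j (fun x => c * phi x) x = c * partial j phi x.
Proof.
move=> [dphi cphi].
have pE j x : partial j (fun x => c * phi x) x = c * partial j phi x.
  rewrite /partial -[X in 'D_(_) X x]/(c *: phi) deriveZ//.
  exact: diff_derivable.
split=> //; split=> [x|j].
  exact: (differentiableZ c (dphi x)).
rewrite (_ : partial j _ = (fun x => c * partial j phi x)); last exact/funext/pE.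
by move=> x; exact: (cvgM (cvg_cst c) (cphi j x)).
Qed.

Let C1_part (phi : V -> R) lam : Defs.C1 phi -> (forall x, `|phi x| <= C * psi gamma x) ->
  (forall j x, `|partial j phi x| <= C * psi beta x) -> 1 <= lam ->
  Defs.C1 (fun x => r lam * translates phi lam (lam *: x)) /\
  forall j x, partial j (fun x : V => r lam * translates phi lam (lam *: x)) x =
    r lam * (lam * translates (partial j phi) lam (lam *: x)).
Proof.
move=> phiC1 phiC dphiC lam1.
have [S1 S2] := scaled_sum_C1 d0 d_gamma C0 d_beta C0 phiC1 phiC dphiC lam1.
have -> : (fun x => r lam * translates phi lam (lam *: x)) =
    (fun x => r lam * scaled_sum phi lam x).
  by apply/funext => x; rewrite scaled_sumE.
have [T1 T2] := C1_scaled (r lam) S1.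
by split=> // j x; rewrite T2 S2.
Qed.

Let reP lam : re (P lam) = (fun x => r lam * translates u lam (lam *: x)).
Proof. exact/funext/re_periodize. Qed.

Let imP lam : im (P lam) = (fun x => r lam * translates v lam (lam *: x)).
Proof. exact/funext/im_periodize. Qed.

Lemma periodize_C1 lam : 1 <= lam -> cC1 (P lam).
Proof.
move=> lam1; rewrite /cC1 reP imP.
by split; [have [] := C1_part uC1 u_decay du_decay lam1|
           have [] := C1_part vC1 v_decay dv_decay lam1].
Qed.

Let dreP lam j x : 1 <= lam -> partial j (re (P lam)) x =
  r lam * (lam * translates (partial j u) lam (lam *: x)).
Proof. by move=> lam1; rewrite reP; have [_ ->] := C1_part uC1 u_decay du_decay lam1. Qed.

Let dimP lam j x : 1 <= lam -> partial j (im (P lam)) x =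
  r lam * (lam * translates (partial j v) lam (lam *: x)).
Proof. by move=> lam1; rewrite imP; have [_ ->] := C1_part vC1 v_decay dv_decay lam1. Qed.

Lemma periodize_periodic lam : periodic (P lam).
Proof.
move=> k x; rewrite /P /periodize; congr (_ * _).
have -> : (fun l : 'rV[int]_d => f (lam *: (x + of_Zd k + of_Zd l))) =
    (fun l => (fun l' => f (lam *: (x + of_Zd l'))) (l + k)).
  by apply/funext => l; rewrite of_ZdD (addrC (of_Zd l)) addrA.
rewrite /clattice_sum.
by rewrite (lattice_sum_shift (fun l => complex.Re (f (lam *: (x + of_Zd l)))))
   (lattice_sum_shift (fun l => complex.Im (f (lam *: (x + of_Zd l))))).
Qed.

Lemma periodize_H1 lam : 1 <= lam -> H1 Torus (P lam).
Proof. by move=> lam1; apply: C1_H1_torus; [exact: periodize_C1|exact: periodize_periodic]. Qed.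

Let w x := u x * u x + v x * v x.
Let wP lam y := translates u lam y * translates u lam y +
  translates v lam y * translates v lam y.

Let normcP lam x : 1 <= lam -> normc (P lam x) ^+ 2 = lam ^+ d * wP lam (lam *: x).
Proof.
move=> lam1; rewrite normc_sqr -/(re (P lam) x) -/(im (P lam) x).
rewrite re_periodize im_periodize -r2// /wP; ring.
Qed.

Let gu : dominated_cvg gamma (translates u) u.
Proof. exact: (dominated_cvg_translates d0 d_gamma C0 cu u_decay). Qed.
Let gv : dominated_cvg gamma (translates v) v.
Proof. exact: (dominated_cvg_translates d0 d_gamma C0 cv v_decay). Qed.
Let gdu (j : 'I_d) : dominated_cvg beta (translates (partial j u)) (partial j u).
Proof. exact: (dominated_cvg_translates d0 d_beta C0 (@cdu j) (du_decay j)). Qed.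
Let gdv (j : 'I_d) : dominated_cvg beta (translates (partial j v)) (partial j v).
Proof. exact: (dominated_cvg_translates d0 d_beta C0 (@cdv j) (dv_decay j)). Qed.
Let gw : dominated_cvg (gamma + gamma) wP w.
Proof. exact: (dominated_cvgD (dominated_cvgM gu gu) (dominated_cvgM gv gv)). Qed.

Let creP lam : 1 <= lam -> continuous (re (P lam)).
Proof. by move=> lam1; apply: C1_continuous; have [] := periodize_C1 lam1. Qed.
Let cimP lam : 1 <= lam -> continuous (im (P lam)).
Proof. by move=> lam1; apply: C1_continuous; have [] := periodize_C1 lam1. Qed.

Let cnormP lam : 1 <= lam -> continuous (fun x : V => normc (P lam x) ^+ 2).
Proof.
move=> lam1; rewrite (_ : (fun x => _) = (fun x => re (P lam) x * re (P lam) x +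
    im (P lam) x * im (P lam) x)); last by apply/funext => x; rewrite normc_sqr.
by move=> x; exact: (cvgD (cvgM (@creP _ lam1 x) (@creP _ lam1 x))
  (cvgM (@cimP _ lam1 x) (@cimP _ lam1 x))).
Qed.

Lemma norm2_sqr (D : set V) (g : V -> R[i]) :
  norm2 D g ^+ 2 = Rintegral mu D (fun x => normc (g x) ^+ 2).
Proof. by rewrite sqr_sqrtr// Rintegral_ge0// => x _; exact: sqr_ge0. Qed.

Let norm2_f : norm2 (dom Euclid) f ^+ 2 = Rintegral mu setT w.
Proof. by rewrite norm2_sqr; apply: eq_Rintegral => x _; rewrite normc_sqr !expr2. Qed.

Let dgg : d%:R < gamma + gamma.
Proof. by rewrite (lt_trans d_gamma2)// gtrBl. Qed.

(** The zeroth moment, whose integrand is |F|^2 itself. *)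
Lemma cvg_norm2 : norm2 (dom Torus) (P lam) ^+ 2 @[lam --> +oo] -->
  norm2 (dom Euclid) f ^+ 2.
Proof.
rewrite norm2_f.
have := torus_limit d0 (c := cst 1) (g := fun lam x => normc (P lam x) ^+ 2) dgg gw cnormP.
rewrite (_ : (fun lam => _ * _) = (fun lam => norm2 (dom Torus) (P lam) ^+ 2)).
  by apply=> lam x lam1; rewrite mul1r normcP.
by apply/funext => lam; rewrite mul1r norm2_sqr.
Qed.

Let inner_opAT D j (F : V -> R[i]) :
  complex.Re (inner D (opAT j F) F) =
    Rintegral mu D (fun x => cos (2 * pi * x ord0 j) * normc (F x) ^+ 2) /\
  complex.Im (inner D (opAT j F) F) =
    Rintegral mu D (fun x => sin (2 * pi * x ord0 j) * normc (F x) ^+ 2).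
Proof.
split; apply: eq_Rintegral => x _; rewrite normc_sqr /re /im /opAT;
  case: (F x) => a b /=; ring.
Qed.

Lemma inner_opA j (F : V -> R[i]) :
  complex.Re (inner (dom Euclid) (opA j F) F) =
    Rintegral mu setT (fun x => 2 * pi * x ord0 j * normc (F x) ^+ 2) /\
  complex.Im (inner (dom Euclid) (opA j F) F) = 0.
Proof.
split.
  apply: eq_Rintegral => x _; rewrite normc_sqr /re /opA.
  by case: (F x) => a b /=; ring.
rewrite /= [LHS](_ : _ = Rintegral mu setT (fun=> 0)).
  by rewrite Rintegral_cst ?mul0r.
by apply: eq_Rintegral => x _; rewrite /im /opA; case: (F x) => a b /=; ring.
Qed.

Let norm_opA j (F : V -> R[i]) x :
  normc (opA j F x) ^+ 2 = (2 * pi * x ord0 j) ^+ 2 * normc (F x) ^+ 2.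
Proof. by rewrite !normc_sqr /opA; case: (F x) => a b /=; ring. Qed.

Let coordK (c lam : R) (x : V) j : 1 <= lam ->
  c * (lam *: x) ord0 j / lam = c * x ord0 j.
Proof.
move=> lam1; have l0 : lam != 0 by rewrite gt_eqF// (lt_le_trans _ lam1).
by rewrite mxE mulrCA mulrAC divff// mul1r.
Qed.

Let continuous_weight (h : R -> R) (c : R) j : continuous h ->
  continuous (fun x : V => h (c * x ord0 j)).
Proof.
move=> ch x; apply: (@continuous_comp _ _ _ (fun x : V => c * x ord0 j) h).
  exact: (cvgM (cvg_cst c) (@coord_continuous R 1 d ord0 j x)).
exact: ch.
Qed.

Let continuous_weightP (h : R -> R) (c : R) j lam : continuous h -> 1 <= lam ->
  continuous (fun x : V => h (c * x ord0 j) * normc (P lam x) ^+ 2).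
Proof.
move=> ch lam1 x.
exact: (cvgM (@continuous_weight h c j ch x) (@cnormP lam lam1 x)).
Qed.

Lemma cvg_inner_opAT_re j :
  complex.Re (inner (dom Torus) (opAT j (P lam)) (P lam)) @[lam --> +oo] -->
  norm2 (dom Euclid) f ^+ 2.
Proof.
rewrite norm2_f.
have ds : d%:R < 0 + (gamma + gamma) by rewrite add0r.
have cg lam : 1 <= lam -> continuous (fun x : V => cos (2 * pi * x ord0 j) * normc (P lam x) ^+ 2).
  by move=> lam1; apply: continuous_weightP => //; exact: continuous_cos.
have := torus_limit d0 (c := cst 1) ds (dominated_cvgM (dominated_cvg_cos (2 * pi) j) gw) cg.
rewrite (_ : (fun y => 1 * w y) = w); last by apply/funext => y; rewrite mul1r.
rewrite (_ : (fun lam => _ * _) = (fun lam =>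
  complex.Re (inner (dom Torus) (opAT j (P lam)) (P lam)))).
  by apply=> lam x lam1; rewrite mul1r normcP// coordK//; ring.
by apply/funext => lam; rewrite mul1r (inner_opAT _ _ _).1.
Qed.

Lemma cvg_inner_opAT_im j :
  lam * complex.Im (inner (dom Torus) (opAT j (P lam)) (P lam)) @[lam --> +oo] -->
  complex.Re (inner (dom Euclid) (opA j f) f).
Proof.
have ds : d%:R < - 1 + (gamma + gamma) by move: d_gamma2; lra.
have cg lam : 1 <= lam -> continuous (fun x : V => sin (2 * pi * x ord0 j) * normc (P lam x) ^+ 2).
  by move=> lam1; apply: continuous_weightP => //; exact: continuous_sin.
have := torus_limit d0 (c := id) ds (dominated_cvgM (dominated_cvg_sin (2 * pi) j) gw) cg.
rewrite (_ : Rintegral mu setT _ = complex.Re (inner (dom Euclid) (opA j f) f)); last first.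
  rewrite (inner_opA _ _).1; apply: eq_Rintegral => x _.
  by rewrite normc_sqr !expr2.
rewrite (_ : (fun lam => _ * _) = (fun lam => lam *
  complex.Im (inner (dom Torus) (opAT j (P lam)) (P lam)))).
  by apply=> lam x lam1; rewrite normcP// coordK//=; ring.
by apply/funext => lam; rewrite (inner_opAT _ _ _).2.
Qed.

(** 1 - cos(2 t) = 2 sin(t)^2 turns the second-order quantity into the square of
    a first-order one, 2 lam sin(pi y_j / lam), which tends to 2 pi y_j.  This is
    where the integrability of |y|^2 |f|^2 is used. *)
Lemma cvg_deficit j :
  2 * lam ^+ 2 * (norm2 (dom Torus) (P lam) ^+ 2 -
    complex.Re (inner (dom Torus) (opAT j (P lam)) (P lam))) @[lam --> +oo] -->
  norm2 (dom Euclid) (opA j f) ^+ 2.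
Proof.
have ds : d%:R < - 1 + - 1 + (gamma + gamma) by move: d_gamma2; lra.
have g1 := dominated_cvgZ 2 (dominated_cvg_sin (pi : R) j).
have cg lam : 1 <= lam -> continuous (fun x : V =>
    (1 - cos (2 * pi * x ord0 j)) * normc (P lam x) ^+ 2).
  move=> lam1; apply: (continuous_weightP (h := fun t => 1 - cos t)) => // t.
  exact: (cvgB (cvg_cst _) (@continuous_cos R t)).
have := torus_limit d0 (c := fun lam => 2 * lam ^+ 2) ds
  (dominated_cvgM (dominated_cvgM g1 g1) gw) cg.
rewrite (_ : Rintegral mu setT _ = norm2 (dom Euclid) (opA j f) ^+ 2); last first.
  rewrite norm2_sqr; apply: eq_Rintegral => x _.
  by rewrite norm_opA normc_sqr /w /u /v /re /im; ring.
move=> H.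
apply: cvg_trans (H _); last first.
  move=> lam x lam1; rewrite normcP// coordK// (one_sub_cos (2 * _ * _)).
  rewrite (_ : 2 * pi * x ord0 j / 2 = pi * x ord0 j); first by ring.
  by field.
apply: near_eq_cvg; near=> lam.
have lam1 : 1 <= lam by near: lam; apply: nbhs_pinfty_ge; rewrite num_real.
congr (_ * _); rewrite norm2_sqr (inner_opAT _ _ _).1 -RintegralB.
- by apply: eq_Rintegral => x _; rewrite mulrBl mul1r.
- exact: measurable_torus.
- exact/integrable_torus/cnormP.
- apply: integrable_torus; apply: continuous_weightP => //; exact: continuous_cos.
Unshelve. all: by end_near. Qed.

Let k : R := (2 * pi)^-1.

Let opB_torus lam j : 1 <= lam ->
  opB Torus j (P lam) = (fun x => (0 +i* k)%C * cpartial j (P lam) x).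
Proof.
by move=> lam1; apply/funext => x; rewrite /opB /deriv_rep asboolT//; exact: periodize_C1.
Qed.

Let opB_euclid j : opB Euclid j f = (fun x => (0 +i* k)%C * cpartial j f x).
Proof. by apply/funext => x; rewrite /opB /deriv_rep asboolT. Qed.

Let norm_opB (F : V -> R[i]) j x :
  normc ((0 +i* k)%C * cpartial j F x) ^+ 2 =
  k ^+ 2 * (partial j (re F) x * partial j (re F) x +
            partial j (im F) x * partial j (im F) x).
Proof. by rewrite normc_sqr /cpartial /=; ring. Qed.

Let inner_opB_re (F : V -> R[i]) j x :
  complex.Re ((0 +i* k)%C * cpartial j F x * (F x)^*%C) =
  k * (partial j (re F) x * im F x + (- 1) * (partial j (im F) x * re F x)).
Proof.
have {1}-> : F x = (re F x +i* im F x)%C by rewrite /re /im; case: (F x).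
by rewrite /cpartial /=; ring.
Qed.

Let inner_opB_im (F : V -> R[i]) j x :
  complex.Im ((0 +i* k)%C * cpartial j F x * (F x)^*%C) =
  k * (partial j (re F) x * re F x + partial j (im F) x * im F x).
Proof.
have {1}-> : F x = (re F x +i* im F x)%C by rewrite /re /im; case: (F x).
by rewrite /cpartial /=; ring.
Qed.

Let cdreP lam j : 1 <= lam -> continuous (partial j (re (P lam))).
Proof. by move=> lam1; have [[_]] := periodize_C1 lam1. Qed.
Let cdimP lam j : 1 <= lam -> continuous (partial j (im (P lam))).
Proof. by move=> lam1; have [_ [_]] := periodize_C1 lam1. Qed.

(** Each derivative of the periodization carries one factor lam. *)
Lemma cvg_norm_opB j :
  lam ^- 2 * norm2 (dom Torus) (opB Torus j (P lam)) ^+ 2 @[lam --> +oo] -->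
  norm2 (dom Euclid) (opB Euclid j f) ^+ 2.
Proof.
have ds : d%:R < beta + beta.
  by rewrite ltr_wpDl// (le_trans _ (ltW d_beta)).
have g := dominated_cvgZ (k ^+ 2) (dominated_cvgD (dominated_cvgM (gdu j) (gdu j))
  (dominated_cvgM (gdv j) (gdv j))).
have cg lam : 1 <= lam -> continuous (fun x : V => k ^+ 2 *
    (partial j (re (P lam)) x * partial j (re (P lam)) x +
     partial j (im (P lam)) x * partial j (im (P lam)) x)).
  move=> lam1 x; exact: (cvgM (cvg_cst _) (cvgD (cvgM (@cdreP _ j lam1 x) (@cdreP _ j lam1 x))
    (cvgM (@cdimP _ j lam1 x) (@cdimP _ j lam1 x)))).
have H := torus_limit d0 (c := fun lam => lam ^- 2) ds g cg.
rewrite norm2_sqr opB_euclid.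
under eq_Rintegral do rewrite norm_opB.
apply: cvg_trans (H _); last first.
  move=> lam x lam1; have l0 : lam != 0 by rewrite gt_eqF// (lt_le_trans _ lam1).
  by rewrite dreP// dimP// -r2//; field.
apply: near_eq_cvg; near=> lam.
have lam1 : 1 <= lam by near: lam; apply: nbhs_pinfty_ge; rewrite num_real.
rewrite norm2_sqr opB_torus//; congr (_ * _).
by apply: eq_Rintegral => x _; rewrite norm_opB.
Unshelve. all: by end_near. Qed.

Lemma cvg_inner_opB_re j :
  lam^-1 * complex.Re (inner (dom Torus) (opB Torus j (P lam)) (P lam)) @[lam --> +oo] -->
  complex.Re (inner (dom Euclid) (opB Euclid j f) f).
Proof.
have ds : d%:R < beta + gamma.
  by rewrite ltr_wpDl// (le_trans _ (ltW d_beta)).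
have g := dominated_cvgZ k (dominated_cvgD (dominated_cvgM (gdu j) gv)
  (dominated_cvgZ (- 1) (dominated_cvgM (gdv j) gu))).
have cg lam : 1 <= lam -> continuous (fun x : V => k *
    (partial j (re (P lam)) x * im (P lam) x +
     (- 1) * (partial j (im (P lam)) x * re (P lam) x))).
  move=> lam1 x; exact: (cvgM (cvg_cst _) (cvgD (cvgM (@cdreP _ j lam1 x) (@cimP _ lam1 x))
    (cvgM (cvg_cst _) (cvgM (@cdimP _ j lam1 x) (@creP _ lam1 x))))).
have H := torus_limit d0 (c := fun lam => lam^-1) ds g cg.
rewrite /inner /cintegral [complex.Re _]/= opB_euclid /re.
under eq_Rintegral do rewrite inner_opB_re.
apply: cvg_trans (H _); last first.
  move=> lam x lam1; have l0 : lam != 0 by rewrite gt_eqF// (lt_le_trans _ lam1).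
  by rewrite dreP// dimP// re_periodize im_periodize -r2//; field.
apply: near_eq_cvg; near=> lam.
have lam1 : 1 <= lam by near: lam; apply: nbhs_pinfty_ge; rewrite num_real.
rewrite opB_torus//; congr (_ * _).
by apply: eq_Rintegral => x _; rewrite inner_opB_re.
Unshelve. all: by end_near. Qed.

Lemma cvg_inner_opB_im j :
  lam^-1 * complex.Im (inner (dom Torus) (opB Torus j (P lam)) (P lam)) @[lam --> +oo] -->
  complex.Im (inner (dom Euclid) (opB Euclid j f) f).
Proof.
have ds : d%:R < beta + gamma.
  by rewrite ltr_wpDl// (le_trans _ (ltW d_beta)).
have g := dominated_cvgZ k (dominated_cvgD (dominated_cvgM (gdu j) gu)
  (dominated_cvgM (gdv j) gv)).
have cg lam : 1 <= lam -> continuous (fun x : V => k *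
    (partial j (re (P lam)) x * re (P lam) x +
     partial j (im (P lam)) x * im (P lam) x)).
  move=> lam1 x; exact: (cvgM (cvg_cst _) (cvgD (cvgM (@cdreP _ j lam1 x) (@creP _ lam1 x))
    (cvgM (@cdimP _ j lam1 x) (@cimP _ lam1 x)))).
have H := torus_limit d0 (c := fun lam => lam^-1) ds g cg.
rewrite /inner /cintegral [complex.Im _]/= opB_euclid /im.
under eq_Rintegral do rewrite inner_opB_im.
apply: cvg_trans (H _); last first.
  move=> lam x lam1; have l0 : lam != 0 by rewrite gt_eqF// (lt_le_trans _ lam1).
  by rewrite dreP// dimP// re_periodize im_periodize -r2//; field.
apply: near_eq_cvg; near=> lam.
have lam1 : 1 <= lam by near: lam; apply: nbhs_pinfty_ge; rewrite num_real.
rewrite opB_torus//; congr (_ * _).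
by apply: eq_Rintegral => x _; rewrite inner_opB_im.
Unshelve. all: by end_near. Qed.

End periodization.

(** * Convergence of the uncertainty product *)

(** The decay hypotheses, stated with the Euclidean norm away from the origin,
    become global bounds by the weights with one constant for the function and
    all its derivatives.  The condition gamma > d/2 + 1 appears as
    2 gamma - 2 > d, the form in which it is used. *)
Lemma admissible_bounds (R : realType) (d : nat) (f : 'rV[R]_d -> R[i]) :
  admissible f -> exists gamma beta C : R,
  [/\ d%:R < gamma /\ d%:R < gamma + gamma - 2, d%:R < beta, 0 <= C,
    forall x, normc (f x) <= C * psi gamma x &
    forall j x, normc (cpartial j f x) <= C * psi beta x].
Proof.
move=> [_ _ fC1 _ [c1 [c2 [beta [gamma [c1p c2p dbeta dgamma fb]]]]]].
have [[du cdu] [dv cdv]] := fC1.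
have cu : continuous (re f) by apply: C1_continuous; case: fC1.
have cv : continuous (im f) by apply: C1_continuous; case: fC1.
move: dgamma; rewrite gt_max => /andP[dg2 dg].
have beta0 : 0 < beta by rewrite (le_lt_trans _ dbeta).
have gamma0 : 0 < gamma by rewrite (le_lt_trans _ dg).
have [C1 C10 uC] : exists2 C, 0 <= C & forall x, `|re f x| <= C * psi gamma x.
  apply: (decay_psi gamma0 (ltW c1p) cu) => x x0.
  exact: le_trans (normRe_le _) (fb x x0).1.
have [C2 C20 vC] : exists2 C, 0 <= C & forall x, `|im f x| <= C * psi gamma x.
  apply: (decay_psi gamma0 (ltW c1p) cv) => x x0.
  exact: le_trans (normIm_le _) (fb x x0).1.
have duC j : exists C, 0 <= C /\ forall x, `|partial j (re f) x| <= C * psi beta x.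
  have [|C C0 bC] := decay_psi beta0 (ltW c2p) (cdu j); last by exists C.
  move=> x x0; exact: le_trans (normRe_le (cpartial j f x)) ((fb x x0).2 j).
have dvC j : exists C, 0 <= C /\ forall x, `|partial j (im f) x| <= C * psi beta x.
  have [|C C0 bC] := decay_psi beta0 (ltW c2p) (cdv j); last by exists C.
  move=> x x0; exact: le_trans (normIm_le (cpartial j f x)) ((fb x x0).2 j).
have [D1 D1P] := choice duC; have [D2 D2P] := choice dvC.
have D10 j : 0 <= D1 j by case: (D1P j).
have D20 j : 0 <= D2 j by case: (D2P j).
pose C := C1 + C2 + \sum_j (D1 j + D2 j).
have S0 : 0 <= \sum_j (D1 j + D2 j) by rewrite sumr_ge0// => j _; rewrite addr_ge0.
have normc_le (z : R[i]) : normc z <= `|complex.Re z| + `|complex.Im z|.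
  rewrite -ler_sqr ?nnegrE ?normc_ge0 ?addr_ge0// normc_sqr sqrrD.
  rewrite !real_normK ?num_real// addrAC lerDl.
  by rewrite mulrn_wge0// mulr_ge0.
exists gamma, beta, C; split=> //; last 3 first.
- by rewrite !addr_ge0.
- move=> x; apply: le_trans (normc_le _) _.
  apply: le_trans (lerD (uC x) (vC x)) _.
  by rewrite -mulrDl ler_wpM2r ?psi_ge0// lerDl.
- move=> j x; apply: le_trans (normc_le _) _.
  apply: le_trans (lerD ((D1P j).2 x) ((D2P j).2 x)) _.
  rewrite -mulrDl ler_wpM2r ?psi_ge0// (@le_trans _ _ (\sum_j (D1 j + D2 j)))//.
    by rewrite (bigD1 j)//= lerDl sumr_ge0// => i _; rewrite addr_ge0.
  by rewrite lerDr addr_ge0.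
by split=> //; move: dg2; lra.
Qed.

Lemma norm2_gt0 (R : realType) (d : nat) (f : 'rV[R]_d -> R[i]) :
  L2on Euclid f -> ~ {ae (@lebesgue_rV R d), forall x, f x = 0} ->
  0 < norm2 (dom Euclid) f ^+ 2.
Proof.
move=> [mr mi fin] f0; rewrite lt0r sqr_ge0 andbT; apply/negP => /eqP n0; apply: f0.
set mu := @lebesgue_rV R d.
have mn : measurable_fun [set: 'rV[R]_d] (fun x => (normc (f x) ^+ 2)%:E).
  apply/measurable_EFinP.
  rewrite (_ : (fun x => _) = (fun x => re f x ^+ 2 + im f x ^+ 2)); last first.
    by apply/funext => x; rewrite normc_sqr.
  by apply: measurable_funD; exact: measurable_funX.
have I0 : (\int[mu]_x `|(normc (f x) ^+ 2)%:E| = 0)%E.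
  under eq_integral do rewrite gee0_abs ?lee_fin ?sqr_ge0//.
  move: n0; rewrite norm2_sqr /Rintegral => n0.
  rewrite -[LHS]fineK ?n0//= ge0_fin_numE//.
  by apply: integral_ge0 => x _; rewrite lee_fin sqr_ge0.
have /(ae_eq_integral_abs mu measurableT mn) := I0.
apply: filterS => x /(_ I) [] /eqP.
by rewrite sqrf_eq0 => /eqP /eq0_normc.
Qed.

Section limit.
Context {R : realType} {d : nat}.
Hypothesis d0 : (0 < d)%N.
Local Notation V := 'rV[R]_d.
Variables (f : V -> R[i]) (gamma beta C : R).
Hypotheses (d_gamma : d%:R < gamma) (d_gamma2 : d%:R < gamma + gamma - 2).
Hypotheses (d_beta : d%:R < beta) (C0 : 0 <= C) (fC1 : cC1 f).
Hypotheses (f_decay : forall x, normc (f x) <= C * psi gamma x).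
Hypotheses (df_decay : forall j x, normc (cpartial j f x) <= C * psi beta x).

Let P lam := periodize lam f.
Let n2 := norm2 (dom Euclid) f ^+ 2.
Hypothesis n2_gt0 : 0 < n2.

Let T lam := norm2 (dom Torus) (P lam) ^+ 2.
Let Ij lam j := inner (dom Torus) (opAT j (P lam)) (P lam).
Let Jj lam j := inner (dom Torus) (opB Torus j (P lam)) (P lam).
Let S j := complex.Re (inner (dom Euclid) (opA j f) f).

Let cT : T lam @[lam --> +oo] --> n2.
Proof. exact: (cvg_norm2 d0 d_gamma d_gamma2 d_beta C0 fC1 f_decay df_decay). Qed.
Let cRe j : complex.Re (Ij lam j) @[lam --> +oo] --> n2.
Proof. exact: (cvg_inner_opAT_re d0 d_gamma d_gamma2 d_beta C0 fC1 f_decay df_decay). Qed.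
Let cIm j : lam * complex.Im (Ij lam j) @[lam --> +oo] --> S j.
Proof. exact: (cvg_inner_opAT_im d0 d_gamma d_gamma2 d_beta C0 fC1 f_decay df_decay). Qed.
Let cQ j : 2 * lam ^+ 2 * (T lam - complex.Re (Ij lam j)) @[lam --> +oo] -->
  norm2 (dom Euclid) (opA j f) ^+ 2.
Proof. exact: (cvg_deficit d0 d_gamma d_gamma2 d_beta C0 fC1 f_decay df_decay). Qed.

Let cIm0 j : complex.Im (Ij lam j) @[lam --> +oo] --> (0 : R).
Proof.
have h : 1 / lam * (lam * complex.Im (Ij lam j)) @[lam --> +oo] --> 0 * S j.
  exact: (cvgM (cvg_div_pinfty (1 : R)) (@cIm j)).
rewrite mul0r in h; apply: cvg_trans h; apply: near_eq_cvg; near=> lam.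
have l0 : 0 < lam by near: lam; apply: nbhs_pinfty_gt; rewrite num_real.
by rewrite /= mul1r mulKf// gt_eqF.
Unshelve. all: by end_near. Qed.

Let normcE (z : R[i]) : normc z = Num.sqrt (complex.Re z ^+ 2 + complex.Im z ^+ 2).
Proof. by case: z. Qed.

Lemma cvg_normc_inner_opAT j : normc (Ij lam j) @[lam --> +oo] --> n2.
Proof.
have h : complex.Re (Ij lam j) * complex.Re (Ij lam j) +
    complex.Im (Ij lam j) * complex.Im (Ij lam j) @[lam --> +oo] --> n2 * n2 + 0 * 0.
  exact: (cvgD (cvgM (@cRe j) (@cRe j)) (cvgM (@cIm0 j) (@cIm0 j))).
have hs : Num.sqrt (complex.Re (Ij lam j) * complex.Re (Ij lam j) +
    complex.Im (Ij lam j) * complex.Im (Ij lam j)) @[lam --> +oo] -->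
    Num.sqrt (n2 * n2 + 0 * 0).
  exact: (cvg_comp _ _ h (@sqrt_continuous R _)).
move: hs; rewrite mul0r addr0 -expr2 sqrtr_sqr (ger0_norm (ltW n2_gt0)).
by apply: cvg_trans; apply: near_eq_cvg; near=> lam; rewrite normcE !expr2.
Unshelve. all: by end_near. Qed.

(** With N, C, S the integrals of w against 1, cos and sin, the identity
    N^2 - C^2 - S^2 = (N - C)(N + C) - S^2 separates a factor of order lam^-2
    from one that tends to twice the squared norm. *)
Lemma cvg_angular_variance j :
  lam ^+ 2 * (T lam ^+ 2 - normc (Ij lam j) ^+ 2) @[lam --> +oo] -->
  n2 * dispersion (opA j) f.
Proof.
have -> : n2 * dispersion (opA j) f =
    2^-1 * norm2 (dom Euclid) (opA j f) ^+ 2 * (n2 + n2) - S j * S j.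
  have E0 : complex.Im (inner (dom Euclid) (opA j f) f) = 0 by have [] := inner_opA j f.
  rewrite /dispersion normc_sqr E0 -/n2 -/(S j); field.
  by rewrite gt_eqF.
have h : 2^-1 * (2 * lam ^+ 2 * (T lam - complex.Re (Ij lam j))) *
      (T lam + complex.Re (Ij lam j)) -
    lam * complex.Im (Ij lam j) * (lam * complex.Im (Ij lam j)) @[lam --> +oo] -->
    2^-1 * norm2 (dom Euclid) (opA j f) ^+ 2 * (n2 + n2) - S j * S j.
  have cQ2 : 2^-1 * (2 * lam ^+ 2 * (T lam - complex.Re (Ij lam j))) @[lam --> +oo] -->
      2^-1 * norm2 (dom Euclid) (opA j f) ^+ 2.
    exact: (cvgM (cvg_cst _) (@cQ j)).
  exact: (cvgB (cvgM cQ2 (cvgD cT (@cRe j))) (cvgM (@cIm j) (@cIm j))).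
apply: cvg_trans h; apply: near_eq_cvg; near=> lam.
rewrite normc_sqr; field.
Unshelve. all: by end_near. Qed.

Lemma cvg_frequency_variance j :
  lam ^- 2 * (norm2 (dom Torus) (opB Torus j (P lam)) ^+ 2 / T lam -
    normc (Jj lam j) ^+ 2 / T lam ^+ 2) @[lam --> +oo] -->
  n2^-1 * dispersion (opB Euclid j) f.
Proof.
have h : (lam ^- 2 * norm2 (dom Torus) (opB Torus j (P lam)) ^+ 2) * (T lam)^-1 -
    (lam^-1 * complex.Re (Jj lam j) * (lam^-1 * complex.Re (Jj lam j)) +
     lam^-1 * complex.Im (Jj lam j) * (lam^-1 * complex.Im (Jj lam j))) *
    ((T lam)^-1 * (T lam)^-1) @[lam --> +oo] -->
    norm2 (dom Euclid) (opB Euclid j f) ^+ 2 * n2^-1 -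
    (complex.Re (inner (dom Euclid) (opB Euclid j f) f) *
     complex.Re (inner (dom Euclid) (opB Euclid j f) f) +
     complex.Im (inner (dom Euclid) (opB Euclid j f) f) *
     complex.Im (inner (dom Euclid) (opB Euclid j f) f)) * (n2^-1 * n2^-1).
  have cTV : (T lam)^-1 @[lam --> +oo] --> n2^-1 by apply: cvgV => //; rewrite gt_eqF.
  have cN := cvg_norm_opB d0 d_gamma d_beta C0 fC1 f_decay df_decay (j := j).
  have cR := cvg_inner_opB_re d0 d_gamma d_beta C0 fC1 f_decay df_decay (j := j).
  have cI := cvg_inner_opB_im d0 d_gamma d_beta C0 fC1 f_decay df_decay (j := j).
  exact: (cvgB (cvgM cN cTV) (cvgM (cvgD (cvgM cR cR) (cvgM cI cI)) (cvgM cTV cTV))).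
have -> : n2^-1 * dispersion (opB Euclid j) f =
    norm2 (dom Euclid) (opB Euclid j f) ^+ 2 * n2^-1 -
    (complex.Re (inner (dom Euclid) (opB Euclid j f) f) *
     complex.Re (inner (dom Euclid) (opB Euclid j f) f) +
     complex.Im (inner (dom Euclid) (opB Euclid j f) f) *
     complex.Im (inner (dom Euclid) (opB Euclid j f) f)) * (n2^-1 * n2^-1).
  rewrite /dispersion normc_sqr -/n2; field.
  by rewrite gt_eqF.
apply: cvg_trans h; apply: near_eq_cvg; near=> lam.
rewrite normc_sqr -!exprVn; ring.
Unshelve. all: by end_near. Qed.

Lemma periodize_UPT_defined : \forall lam \near +oo, UPT_defined (P lam).
Proof.
have nz j : \forall lam \near +oo, Ij lam j != 0.
  have : \forall lam \near +oo, n2 - complex.Re (Ij lam j) < n2.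
    have /cvgrPdist_lt/(_ _ n2_gt0) := @cRe j.
    by apply: filterS => lam; exact: le_lt_trans (ler_norm _).
  apply: filterS => lam; rewrite gtrBl; case: (Ij lam j) => a b /= a0.
  by apply: contraTneq a0 => -[-> _]; rewrite ltxx.
near=> lam; split.
  apply: (periodize_H1 d0 d_gamma d_beta C0 fC1 f_decay df_decay).
  by near: lam; apply: nbhs_pinfty_ge; rewrite num_real.
near: lam; exact: filter_forall.
Unshelve. all: by end_near. Qed.

(** The powers lam^2 and lam^-2 that normalise the two variances cancel in the
    product. *)
Lemma cvg_UPT : UPT (P lam) @[lam --> +oo] --> UP f.
Proof.
have cA : \sum_j lam ^+ 2 * (T lam ^+ 2 - normc (Ij lam j) ^+ 2) @[lam --> +oo] -->
    \sum_j n2 * dispersion (opA j) f.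
  apply: cvg_big => [|j _]; first exact: add_continuous.
  exact: cvg_angular_variance.
have cI : \sum_j normc (Ij lam j) @[lam --> +oo] --> \sum_(j < d) n2.
  apply: cvg_big => [|j _]; first exact: add_continuous.
  exact: cvg_normc_inner_opAT.
have cB : \sum_j lam ^- 2 * (norm2 (dom Torus) (opB Torus j (P lam)) ^+ 2 / T lam -
    normc (Jj lam j) ^+ 2 / T lam ^+ 2) @[lam --> +oo] -->
    \sum_j n2^-1 * dispersion (opB Euclid j) f.
  apply: cvg_big => [|j _]; first exact: add_continuous.
  exact: cvg_frequency_variance.
move: cI; rewrite sumr_const card_ord -mulr_natl => cI.
have dR : d%:R != 0 :> R by rewrite pnatr_eq0 -lt0n.
have nR : n2 != 0 by rewrite gt_eqF.
have cIV : ((\sum_j normc (Ij lam j)) * (\sum_j normc (Ij lam j)))^-1 @[lam --> +oo] -->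
    (d%:R * n2 * (d%:R * n2))^-1.
  have cI2 : (\sum_j normc (Ij lam j)) * (\sum_j normc (Ij lam j)) @[lam --> +oo] -->
    d%:R * n2 * (d%:R * n2) by exact: (cvgM cI cI).
  by apply: cvgV; [do 2 apply: mulf_neq0|exact: cI2].
have h : (\sum_j lam ^+ 2 * (T lam ^+ 2 - normc (Ij lam j) ^+ 2)) *
    ((\sum_j normc (Ij lam j)) * (\sum_j normc (Ij lam j)))^-1 *
    (\sum_j lam ^- 2 * (norm2 (dom Torus) (opB Torus j (P lam)) ^+ 2 / T lam -
      normc (Jj lam j) ^+ 2 / T lam ^+ 2)) @[lam --> +oo] -->
    (\sum_j n2 * dispersion (opA j) f) * (d%:R * n2 * (d%:R * n2))^-1 *
    (\sum_j n2^-1 * dispersion (opB Euclid j) f).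
  exact: (cvgM (cvgM cA cIV) cB).
have -> : UP f = (\sum_j n2 * dispersion (opA j) f) * (d%:R * n2 * (d%:R * n2))^-1 *
    (\sum_j n2^-1 * dispersion (opB Euclid j) f).
  rewrite /UP -!mulr_sumr (exprM _ 2 2) -/n2.
  by field; rewrite dR nR.
apply: cvg_trans h; apply: near_eq_cvg; near=> lam.
have l0 : lam != 0.
  by rewrite gt_eqF//; near: lam; apply: nbhs_pinfty_gt; rewrite num_real.
have T2 : norm2 (dom Torus) (P lam) ^+ 4 = T lam ^+ 2 by rewrite (exprM _ 2 2).
rewrite /UPT -!mulr_sumr -/(P lam) T2 -/(T lam) -expr2.
have E (a b c : R) : lam ^+ 2 * a * c * (lam ^- 2 * b) = a * c * b by field.
exact: E.
Unshelve. all: by end_near. Qed.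

End limit.

Theorem theorem6 (R : realType) (d : nat) (f : 'rV[R]_d -> R[i])
    (d_gt0 : (0 < d)%N) (f_adm : admissible f) :
  (\forall lam \near +oo, UPT_defined (periodize lam f)) /\
  UPT (periodize lam f) @[lam --> +oo] --> UP f.
Proof.
have [gamma [beta [C [[dg dg2] db C0 fC dfC]]]] := admissible_bounds f_adm.
have [fL2 f0 fC1 _ _] := f_adm.
have n2 := norm2_gt0 fL2 f0.
split; first exact: (periodize_UPT_defined d_gt0 dg dg2 db C0 fC1 fC dfC n2).
exact: (cvg_UPT d_gt0 dg dg2 db C0 fC1 fC dfC n2).
Qed.
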